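(* Let $f^*:\mathscr{D}\to\mathscr{C}$ be a geometric functor between rigidly-compactly generated tensor-triangulated categories, with adjoints $f^*\dashv f_*\dashv f^!$ and relative dualizing object $\omega_f:=f^!(\mathbb{1}_{\mathscr{D}})$. Consider the thick $\otimes$-ideal $$\mathscr{A}_f:=\{x\in\mathscr{C}^c \mid f_*(x\otimes y)\text{ is compact for all }y\in\mathscr{C}^c\}\subseteq\mathscr{C}^c,$$ let $\mathscr{B}:=\mathrm{Loc}\langle\mathscr{A}_f\rangle\subseteq\mathscr{C}$, let $\Gamma_!:\mathscr{B}\hookrightarrow\mathscr{C}$ be the inclusion and let $\Gamma^*:\mathscr{C}\to\mathscr{B}$ be the right adjoint of $\Gamma_!$. Then: (a) The composite $\Gamma^*\circ f^!:\mathscr{D}\to\mathscr{B}$ has a right adjoint. (b) There is a canonical natural isomorphism $\Gamma^*\circ f^!\cong\Gamma^*(\omega_f\otimes f^*(-))$, namely $\Gamma^*(\psi)$. (c) There is a canonical natural isomorphism $\Gamma^*\circ f^*\cong\Gamma^*(\mathsf{hom}(\omega_f,f^!(-)))$, namely $\Gamma^*(\psi^{\mathrm{ad}})$. (d) The composite $\Gamma^*\circ f^*:\mathscr{D}\to\mathscr{B}$ has a left adjoint, denoted $(f\circ\Gamma)_!:\mathscr{B}\to\mathscr{D}$, and there is a canonical natural isomorphism $$(f\circ\Gamma)_!(x)\cong f_*(\Gamma_!(x)\otimes\omega_f)$$ for all $x\in\mathscr{B}$, namely the one obtained from $\Gamma^*(\psi^{\mathrm{ad}})$ by passing to left adjo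ints.
   Context: A tensor-triangulated category is a triangulated category with a compatible closed symmetric monoidal structure ($\otimes$, unit $\mathbb{1}$, internal hom $\mathsf{hom}$). It is rigidly-compactly generated if it is compactly generated as a triangulated category (with all small coproducts) and its compact objects coincide with its rigid (strongly dualizable) objects; in particular $\mathbb{1}$ is compact. $\mathscr{C}^c$ denotes the full subcategory of compact objects. A geometric functor is a coproduct-preserving triangulated strong (symmetric) monoidal functor between rigidly-compactly generated tensor-triangulated categories. Any geometric functor $f^*$ has a right adjoint $f_*$, which itself has a right adjoint $f^!$, and the projection formula $f_*(f^*x\otimes y)\cong x\otimes f_*y$ holds. $\mathrm{Loc}\langle\mathscr{A}_f\rangle$ is the smallest localizing subcategory (triangulated subcategory closed under coproducts) of $\mathscr{C}$ containing $\mathscr{A}_f$; the inclusion $\Gamma_!$ has a right adjoint $\Gamma^*$ (finite colocalization). The natural map $\psi:f^*x\otimes\omega_f\to f^!(x)$ is the adjoint (for $f_*\dashv f^!$) of the composite $f_*(f^*x\otimes\omega_f)\cong x\otimes f_*\omega_f\xrightarrow{1\otimes\epsilon}x\otimes\mathbb{1}\cong x$, where the first isomorphism is the projection formula and $\epsilon:f_*f^!\mathbb{1}\to\mathbb{1}$ is the counit. The map $\psi^{\mathrm{ad}}:f^*x\to\mathsf{hom}(\omega_f,f^!x)$ is adjoint to $\psi$ under the tensor-hom adjunction. The functor $f_*(\Gamma_!(-)\otimes\omega_f)$ is left adjoint to $\Gamma^*\mathsf{hom}(\omega_f,f^!(-))$. *)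

(* Defs.v *)
From mathcomp Require Import all_boot ssralg.
From mathcomp Require Import boolp classical_sets.

Set Implicit Arguments.
Unset Strict Implicit.
Unset Printing Implicit Defensive.

Import GRing.Theory.
Local Open Scope ring_scope.

(* The universe of small sets: the one in which hom groups live, so that every
   category below is locally small and "small coproduct" means a coproduct
   indexed by a set of this size.  Objects may form a larger type. *)
Definition small := Type@{Algebra.Zmodule.axioms_.u0}.

Declare Scope cat_scope.
Delimit Scope cat_scope with cat.
Local Open Scope cat_scope.

Reserved Notation "g ∘ f" (at level 40, left associativity).
Reserved Notation "G ⊙ F" (at level 40, left associativity).
Reserved Notation "X ⊗ Y" (at level 38, left associativity).
Reserved Notation "u ⊠ v" (at level 38, left associativity).

Record category := Category {
  ob :> Type;
  Hom : ob -> ob -> zmodType;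
  idm : forall X, Hom X X;
  comp : forall X Y Z, Hom Y Z -> Hom X Y -> Hom X Z;
  comp1m : forall X Y (f : Hom X Y), comp (idm Y) f = f;
  compm1 : forall X Y (f : Hom X Y), comp f (idm X) = f;
  compA : forall W X Y Z (h : Hom Y Z) (g : Hom X Y) (f : Hom W X),
    comp h (comp g f) = comp (comp h g) f;
  compDl : forall X Y Z (g g' : Hom Y Z) (f : Hom X Y),
    comp (g + g') f = comp g f + comp g' f;
  compDr : forall X Y Z (g : Hom Y Z) (f f' : Hom X Y),
    comp g (f + f') = comp g f + comp g f'
}.
Arguments idm {c} X.
Notation "g ∘ f" := (comp g f) : cat_scope.

Definition is_inverse (C : category) (X Y : C) (f : Hom X Y) (g : Hom Y X) :=
  g ∘ f = idm X /\ f ∘ g = idm Y.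
Definition is_iso (C : category) (X Y : C) (f : Hom X Y) :=
  exists g, is_inverse f g.
(* Total inverse: the inverse of [f] when [f] is invertible, and 0 otherwise. *)
Definition inv (C : category) (X Y : C) (f : Hom X Y) : Hom Y X :=
  xget 0 [set g | is_inverse f g].

Definition is_zero (C : category) (Z : C) :=
  (forall X (f : Hom X Z), f = 0) /\ (forall X (f : Hom Z X), f = 0).

Definition is_biprod (C : category) (X Y P : C) (i1 : Hom X P) (i2 : Hom Y P)
    (p1 : Hom P X) (p2 : Hom P Y) :=
  [/\ p1 ∘ i1 = idm X, p2 ∘ i2 = idm Y, p1 ∘ i2 = 0, p2 ∘ i1 = 0
    & i1 ∘ p1 + i2 ∘ p2 = idm P].

Definition is_coprod (C : category) (I : small) (y : I -> C) (Y : C)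
    (inj : forall i, Hom (y i) Y) :=
  forall (Z : C) (h : forall i, Hom (y i) Z),
    exists! u : Hom Y Z, forall i, u ∘ inj i = h i.

Definition has_coproducts (C : category) :=
  forall (I : small) (y : I -> C),
    exists (Y : C) (inj : forall i, Hom (y i) Y), is_coprod inj.

(* [x] is compact when, for every coproduct [Y] of a small family [y], the
   canonical map from the direct sum of the groups [Hom x (y i)] to [Hom x Y]
   is bijective.  An element of the direct sum is given by finitely many
   components [g k : Hom x (y (s k))] at pairwise distinct indices [s k]; the
   two clauses are surjectivity and injectivity (trivial kernel). *)
Definition compact (C : category) (x : C) :=
  forall (I : small) (y : I -> C) (Y : C) (inj : forall i, Hom (y i) Y),
    is_coprod inj ->
    (forall h : Hom x Y, exists (n : nat) (s : 'I_n -> I)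
        (g : forall k, Hom x (y (s k))),
        injective s /\ h = \sum_(k < n) inj (s k) ∘ g k) /\
    (forall (n : nat) (s : 'I_n -> I) (g : forall k, Hom x (y (s k))),
        injective s -> \sum_(k < n) inj (s k) ∘ g k = 0 ->
        forall k, g k = 0).

Record functor (C D : category) := Functor {
  fob :> C -> D;
  fmap : forall X Y, Hom X Y -> Hom (fob X) (fob Y);
  fmap1 : forall X, fmap (idm X) = idm (fob X);
  fmapM : forall X Y Z (g : Hom Y Z) (f : Hom X Y),
    fmap (g ∘ f) = fmap g ∘ fmap f
}.
Arguments fmap {C D} f {X Y} _ : rename.

Section FComp.
Variables (A B C : category) (G : functor B C) (F : functor A B).
Lemma fcomp1 X : fmap G (fmap F (idm X)) = idm (G (F X)).
Proof. by rewrite !fmap1. Qed.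
Lemma fcompM X Y Z (g : Hom Y Z) (f : Hom X Y) :
  fmap G (fmap F (g ∘ f)) = fmap G (fmap F g) ∘ fmap G (fmap F f).
Proof. by rewrite !fmapM. Qed.
Definition fcomp : functor A C :=
  @Functor A C (fun X => G (F X)) (fun X Y f => fmap G (fmap F f)) fcomp1 fcompM.
End FComp.
Notation "G ⊙ F" := (fcomp G F) : cat_scope.

Definition additive_functor (C D : category) (F : functor C D) :=
  forall X Y (f g : Hom X Y), fmap F (f + g) = fmap F f + fmap F g.

Definition fully_faithful (C D : category) (F : functor C D) :=
  forall X Y, bijective (fun f : Hom X Y => fmap F f).
Definition essentially_surjective (C D : category) (F : functor C D) :=
  forall Y, exists X (f : Hom (F X) Y), is_iso f.

Definition preserves_coproducts (C D : category) (F : functor C D) :=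
  forall (I : small) (y : I -> C) (Y : C) (inj : forall i, Hom (y i) Y),
    is_coprod inj ->
    @is_coprod D I (fun i => F (y i)) (F Y) (fun i => fmap F (inj i)).

Definition natural (C D : category) (F G : functor C D)
    (eta : forall X, Hom (F X) (G X)) :=
  forall X Y (f : Hom X Y), eta Y ∘ fmap F f = fmap G f ∘ eta X.
Definition natural_iso (C D : category) (F G : functor C D)
    (eta : forall X, Hom (F X) (G X)) :=
  natural eta /\ forall X, is_iso (eta X).
Arguments natural {C D} F G eta.
Arguments natural_iso {C D} F G eta.

Record adjunction (C D : category) (L : functor C D) (R : functor D C) :=
  Adjunction {
  unit_adj : forall X, Hom X (R (L X));
  counit_adj : forall Y, Hom (L (R Y)) Y;
  unit_adj_nat : forall X X' (f : Hom X X'),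
    unit_adj X' ∘ f = fmap R (fmap L f) ∘ unit_adj X;
  counit_adj_nat : forall Y Y' (g : Hom Y Y'),
    counit_adj Y' ∘ fmap L (fmap R g) = g ∘ counit_adj Y;
  adj_triL : forall X, counit_adj (L X) ∘ fmap L (unit_adj X) = idm (L X);
  adj_triR : forall Y, fmap R (counit_adj Y) ∘ unit_adj (R Y) = idm (R Y)
}.

Definition has_right_adjoint (C D : category) (F : functor C D) :=
  exists R : functor D C, inhabited (adjunction F R).
Definition has_left_adjoint (C D : category) (F : functor C D) :=
  exists L : functor D C, inhabited (adjunction L F).

Definition ladj (C D : category) (L : functor C D) (R : functor D C)
    (a : adjunction L R) X Y (f : Hom (L X) Y) : Hom X (R Y) :=
  fmap R f ∘ unit_adj a X.
Definition radj (C D : category) (L : functor C D) (R : functor D C)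
    (a : adjunction L R) X Y (g : Hom X (R Y)) : Hom (L X) Y :=
  counit_adj a Y ∘ fmap L g.

Section AdjComp.
Variables (A B C : category) (L1 : functor A B) (R1 : functor B A)
  (L2 : functor B C) (R2 : functor C B)
  (a1 : adjunction L1 R1) (a2 : adjunction L2 R2).
Let eta X : Hom X ((R1 ⊙ R2) ((L2 ⊙ L1) X)) :=
  fmap R1 (unit_adj a2 (L1 X)) ∘ unit_adj a1 X.
Let eps Y : Hom ((L2 ⊙ L1) ((R1 ⊙ R2) Y)) Y :=
  counit_adj a2 Y ∘ fmap L2 (counit_adj a1 (R2 Y)).

Lemma adj_comp_unit_nat X X' (f : Hom X X') :
  eta X' ∘ f = fmap (R1 ⊙ R2) (fmap (L2 ⊙ L1) f) ∘ eta X.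
Proof.
rewrite /eta /= -compA (unit_adj_nat a1) compA -(fmapM R1).
by rewrite (unit_adj_nat a2) fmapM compA.
Qed.
Lemma adj_comp_counit_nat Y Y' (g : Hom Y Y') :
  eps Y' ∘ fmap (L2 ⊙ L1) (fmap (R1 ⊙ R2) g) = g ∘ eps Y.
Proof.
rewrite /eps /= -compA -(fmapM L2) (counit_adj_nat a1) fmapM compA.
by rewrite (counit_adj_nat a2) compA.
Qed.
Lemma adj_comp_triL X : eps ((L2 ⊙ L1) X) ∘ fmap (L2 ⊙ L1) (eta X) = idm _.
Proof.
rewrite /eps /eta /= -compA -(fmapM L2) (fmapM L1) compA (counit_adj_nat a1).
by rewrite -compA (adj_triL a1) compm1 (adj_triL a2).
Qed.
Lemma adj_comp_triR Y : fmap (R1 ⊙ R2) (eps Y) ∘ eta ((R1 ⊙ R2) Y) = idm _.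
Proof.
rewrite /eps /eta /= compA -(fmapM R1) (fmapM R2) -compA -(unit_adj_nat a2).
by rewrite compA (adj_triR a2) comp1m (adj_triR a1).
Qed.
Definition adj_comp : adjunction (L2 ⊙ L1) (R1 ⊙ R2) :=
  Adjunction adj_comp_unit_nat adj_comp_counit_nat adj_comp_triL adj_comp_triR.
End AdjComp.

(* For [L1 -| R1] and [L2 -| R2], the transformation [L2 => L1] corresponding to
   [theta : R1 => R2] under passage to left adjoints. *)
Definition left_mate (C D : category) (L1 L2 : functor C D) (R1 R2 : functor D C)
    (a1 : adjunction L1 R1) (a2 : adjunction L2 R2)
    (theta : forall Y, Hom (R1 Y) (R2 Y)) (X : C) : Hom (L2 X) (L1 X) :=
  radj a2 (theta (L1 X) ∘ unit_adj a1 X).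

Section FullSub.
Variables (C : category) (P : C -> Prop).
Definition full_sub : category :=
  @Category {x : C | P x} (fun x y => Hom (sval x) (sval y))
    (fun x => idm (sval x)) (fun _ _ _ g f => g ∘ f)
    (fun _ _ f => comp1m f) (fun _ _ f => compm1 f)
    (fun _ _ _ _ h g f => compA h g f)
    (fun _ _ _ g g' f => compDl g g' f) (fun _ _ _ g f f' => compDr g f f').
Definition inclusion : functor full_sub C :=
  @Functor full_sub C (fun x => sval x) (fun _ _ f => f)
    (fun _ => erefl) (fun _ _ _ _ _ => erefl).
End FullSub.

Record triangulation (C : category) := Triangulation {
  susp : functor C C;
  dist : forall X Y Z : C, Hom X Y -> Hom Y Z -> Hom Z (susp X) -> Prop;
  zero_ex : exists Z : C, is_zero Z;
  biprod_ex : forall X Y : C, exists (P : C) (i1 : Hom X P) (i2 : Hom Y P)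
    (p1 : Hom P X) (p2 : Hom P Y), is_biprod i1 i2 p1 p2;
  susp_add : additive_functor susp;
  susp_ff : fully_faithful susp;
  susp_es : essentially_surjective susp;
  dist_iso : forall (X Y Z X' Y' Z' : C)
      (f : Hom X Y) (g : Hom Y Z) (h : Hom Z (susp X))
      (f' : Hom X' Y') (g' : Hom Y' Z') (h' : Hom Z' (susp X'))
      (a : Hom X X') (b : Hom Y Y') (c : Hom Z Z'),
    is_iso a -> is_iso b -> is_iso c ->
    b ∘ f = f' ∘ a -> c ∘ g = g' ∘ b -> fmap susp a ∘ h = h' ∘ c ->
    dist f g h -> dist f' g' h';
  dist_id : forall X Z : C, is_zero Z ->
    dist (idm X) (0 : Hom X Z) (0 : Hom Z (susp X));
  dist_ex : forall (X Y : C) (f : Hom X Y),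
    exists (Z : C) (g : Hom Y Z) (h : Hom Z (susp X)), dist f g h;
  dist_rot : forall (X Y Z : C) (f : Hom X Y) (g : Hom Y Z) (h : Hom Z (susp X)),
    dist f g h <-> dist g h (- fmap susp f);
  dist_fill : forall (X Y Z X' Y' Z' : C)
      (f : Hom X Y) (g : Hom Y Z) (h : Hom Z (susp X))
      (f' : Hom X' Y') (g' : Hom Y' Z') (h' : Hom Z' (susp X'))
      (a : Hom X X') (b : Hom Y Y'),
    dist f g h -> dist f' g' h' -> b ∘ f = f' ∘ a ->
    exists c : Hom Z Z', c ∘ g = g' ∘ b /\ fmap susp a ∘ h = h' ∘ c;
  octahedral : forall (X Y Z U V W : C) (f : Hom X Y) (g : Hom Y Z)
      (f1 : Hom Y U) (f2 : Hom U (susp X))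
      (g1 : Hom Z V) (g2 : Hom V (susp Y))
      (k1 : Hom Z W) (k2 : Hom W (susp X)),
    dist f f1 f2 -> dist g g1 g2 -> dist (g ∘ f) k1 k2 ->
    exists (u : Hom U W) (v : Hom W V),
      [/\ dist u v (fmap susp f1 ∘ g2),
          u ∘ f1 = k1 ∘ g, k2 ∘ u = f2, v ∘ k1 = g1
        & g2 ∘ v = fmap susp f ∘ k2]
}.

Record is_localizing (C : category) (T : triangulation C) (P : C -> Prop) : Prop :=
  IsLocalizing {
  loc_susp : forall X, P X <-> P (susp T X);
  loc_dist : forall (X Y Z : C) (f : Hom X Y) (g : Hom Y Z) (h : Hom Z (susp T X)),
    dist f g h -> P X -> P Y -> P Z;
  loc_coprod : forall (I : small) (y : I -> C) (Y : C) (inj : forall i, Hom (y i) Y),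
    is_coprod inj -> (forall i, P (y i)) -> P Y
}.

Definition Loc (C : category) (T : triangulation C) (A : C -> Prop) (x : C) : Prop :=
  forall P : C -> Prop, is_localizing T P -> (forall a, A a -> P a) -> P x.

(* [Hom (Σ^n G) x] for all integers [n]: since Σ is only an equivalence, the
   negative shifts of [G] are moved to positive shifts of [x]. *)
Definition compactly_generated (C : category) (T : triangulation C) :=
  has_coproducts C /\
  exists (I : small) (G : I -> C),
    (forall i, compact (G i)) /\
    forall x : C,
      (forall i (n : nat),
          (forall f : Hom (iter n (susp T) (G i)) x, f = 0) /\
          (forall f : Hom (G i) (iter n (susp T) x), f = 0)) ->
      is_zero x.

Record triangulated_functor (C D : category) (S : triangulation C)
    (T : triangulation D) (F : functor C D) := TriangulatedFunctor {
  tf_add : additive_functor F;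
  tf_susp : forall X, Hom (F (susp S X)) (susp T (F X));
  tf_susp_iso : natural_iso (F ⊙ susp S) (susp T ⊙ F) tf_susp;
  tf_dist : forall X Y Z (f : Hom X Y) (g : Hom Y Z) (h : Hom Z (susp S X)),
    dist f g h -> dist (fmap F f) (fmap F g) (tf_susp X ∘ fmap F h)
}.

Record csmcat := CSMCat {
  csm_cat :> category;
  tens : csm_cat -> csm_cat -> csm_cat;
  tensm : forall X X' Y Y' : csm_cat,
    Hom X X' -> Hom Y Y' -> Hom (tens X Y) (tens X' Y');
  one : csm_cat;
  assoc : forall X Y Z : csm_cat,
    Hom (tens (tens X Y) Z) (tens X (tens Y Z));
  lunit : forall X : csm_cat, Hom (tens one X) X;
  runit : forall X : csm_cat, Hom (tens X one) X;
  sym : forall X Y : csm_cat, Hom (tens X Y) (tens Y X);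
  (* [ihom W X] is the internal hom from [W] to [X] *)
  ihom : csm_cat -> csm_cat -> csm_cat;
  ev : forall W X : csm_cat, Hom (tens (ihom W X) W) X;
  curry : forall Z W X : csm_cat, Hom (tens Z W) X -> Hom Z (ihom W X);
  tensm1 : forall X Y : csm_cat, tensm (idm X) (idm Y) = idm (tens X Y);
  tensmM : forall (X X' X'' Y Y' Y'' : csm_cat) (f' : Hom X' X'') (f : Hom X X')
      (g' : Hom Y' Y'') (g : Hom Y Y'),
    tensm (f' ∘ f) (g' ∘ g) = tensm f' g' ∘ tensm f g;
  tensmDl : forall (X X' Y Y' : csm_cat) (f f' : Hom X X') (g : Hom Y Y'),
    tensm (f + f') g = tensm f g + tensm f' g;
  tensmDr : forall (X X' Y Y' : csm_cat) (f : Hom X X') (g g' : Hom Y Y'),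
    tensm f (g + g') = tensm f g + tensm f g';
  assoc_iso : forall X Y Z : csm_cat, is_iso (assoc X Y Z);
  lunit_iso : forall X : csm_cat, is_iso (lunit X);
  runit_iso : forall X : csm_cat, is_iso (runit X);
  assoc_nat : forall (X X' Y Y' Z Z' : csm_cat)
      (f : Hom X X') (g : Hom Y Y') (h : Hom Z Z'),
    assoc X' Y' Z' ∘ tensm (tensm f g) h = tensm f (tensm g h) ∘ assoc X Y Z;
  lunit_nat : forall (X X' : csm_cat) (f : Hom X X'),
    lunit X' ∘ tensm (idm one) f = f ∘ lunit X;
  runit_nat : forall (X X' : csm_cat) (f : Hom X X'),
    runit X' ∘ tensm f (idm one) = f ∘ runit X;
  sym_nat : forall (X X' Y Y' : csm_cat) (f : Hom X X') (g : Hom Y Y'),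
    sym X' Y' ∘ tensm f g = tensm g f ∘ sym X Y;
  symK : forall X Y : csm_cat, sym Y X ∘ sym X Y = idm (tens X Y);
  triangle_ax : forall X Y : csm_cat,
    tensm (idm X) (lunit Y) ∘ assoc X one Y = tensm (runit X) (idm Y);
  pentagon_ax : forall W X Y Z : csm_cat,
    assoc W X (tens Y Z) ∘ assoc (tens W X) Y Z =
    tensm (idm W) (assoc X Y Z) ∘ assoc W (tens X Y) Z
      ∘ tensm (assoc W X Y) (idm Z);
  hexagon_ax : forall X Y Z : csm_cat,
    assoc Y Z X ∘ sym X (tens Y Z) ∘ assoc X Y Z =
    tensm (idm Y) (sym X Z) ∘ assoc Y X Z ∘ tensm (sym X Y) (idm Z);
  ev_curry : forall (Z W X : csm_cat) (f : Hom (tens Z W) X),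
    ev W X ∘ tensm (curry f) (idm W) = f;
  curry_ev : forall (Z W X : csm_cat) (g : Hom Z (ihom W X)),
    curry (ev W X ∘ tensm g (idm W)) = g
}.
Arguments one {c}.
Notation "X ⊗ Y" := (tens X Y) : cat_scope.
Notation "u ⊠ v" := (tensm u v) : cat_scope.

Section CSM.
Variable C : csmcat.
Implicit Types W X Y Z : C.

Definition ihom_r W X Y (f : Hom X Y) : Hom (ihom W X) (ihom W Y) :=
  curry (f ∘ ev W X).
Definition ihom_l W X Y (f : Hom X Y) : Hom (ihom Y W) (ihom X W) :=
  curry (ev Y W ∘ (idm (ihom Y W) ⊠ f)).

Lemma curry_nat Z Z' W X (f : Hom (Z ⊗ W) X) (g : Hom Z' Z) :
  curry f ∘ g = curry (f ∘ (g ⊠ idm W)).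
Proof.
by rewrite -[LHS]curry_ev -[idm W in LHS]comp1m tensmM compA ev_curry.
Qed.

Lemma tens_r1 W X : idm X ⊠ idm W = idm (X ⊗ W).
Proof. exact: tensm1. Qed.
Lemma tens_rM W X Y Z (g : Hom Y Z) (f : Hom X Y) :
  (g ∘ f) ⊠ idm W = (g ⊠ idm W) ∘ (f ⊠ idm W).
Proof. by rewrite -tensmM comp1m. Qed.
Lemma tens_lM W X Y Z (g : Hom Y Z) (f : Hom X Y) :
  idm W ⊠ (g ∘ f) = (idm W ⊠ g) ∘ (idm W ⊠ f).
Proof. by rewrite -tensmM comp1m. Qed.
Definition tens_right W : functor C C :=
  @Functor C C (fun X => X ⊗ W) (fun X Y f => f ⊠ idm W) (tens_r1 W) (@tens_rM W).
Definition tens_left W : functor C C :=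
  @Functor C C (fun X => W ⊗ X) (fun X Y f => idm W ⊠ f) (fun X => tens_r1 X W)
    (@tens_lM W).

Lemma ihom_r1 W X : ihom_r W (idm X) = idm (ihom W X).
Proof. by rewrite /ihom_r comp1m -[RHS]curry_ev tensm1 compm1. Qed.
Lemma ihom_rM W X Y Z (g : Hom Y Z) (f : Hom X Y) :
  ihom_r W (g ∘ f) = ihom_r W g ∘ ihom_r W f.
Proof. by rewrite /ihom_r curry_nat -(compA g (ev W Y)) ev_curry compA. Qed.
Definition ihom_from W : functor C C :=
  @Functor C C (ihom W) (fun X Y f => ihom_r W f) (ihom_r1 W) (@ihom_rM W).

Lemma tens_hom_unit_nat W X X' (f : Hom X X') :
  curry (idm (X' ⊗ W)) ∘ f = ihom_r W (f ⊠ idm W) ∘ curry (idm (X ⊗ W)).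
Proof. by rewrite /ihom_r !curry_nat -compA ev_curry comp1m compm1. Qed.
Lemma tens_hom_counit_nat W Y Y' (g : Hom Y Y') :
  ev W Y' ∘ (ihom_r W g ⊠ idm W) = g ∘ ev W Y.
Proof. exact: ev_curry. Qed.
Lemma tens_hom_triL W X :
  ev W (X ⊗ W) ∘ (curry (idm (X ⊗ W)) ⊠ idm W) = idm (X ⊗ W).
Proof. exact: ev_curry. Qed.
Lemma tens_hom_triR W Y :
  ihom_r W (ev W Y) ∘ curry (idm (ihom W Y ⊗ W)) = idm (ihom W Y).
Proof.
by rewrite /ihom_r curry_nat -compA ev_curry -[RHS]curry_ev tensm1.
Qed.
Definition tens_hom_adj W : adjunction (tens_right W) (ihom_from W) :=
  @Adjunction C C (tens_right W) (ihom_from W) _ _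
    (@tens_hom_unit_nat W) (@tens_hom_counit_nat W)
    (@tens_hom_triL W) (@tens_hom_triR W).

(* The canonical map hom(x,1) ⊗ y -> hom(x,y): the transpose of
   (hom(x,1) ⊗ y) ⊗ x ≅ (hom(x,1) ⊗ x) ⊗ y -> 1 ⊗ y ≅ y. *)
Definition dual_map X Y : Hom (ihom X one ⊗ Y) (ihom X Y) :=
  curry (lunit Y ∘ (ev X one ⊠ idm Y) ∘ inv (assoc (ihom X one) X Y)
         ∘ (idm (ihom X one) ⊠ sym Y X) ∘ assoc (ihom X one) Y X).
Definition rigid X := forall Y, is_iso (dual_map X Y).
End CSM.

Record strong_symmetric_monoidal (C D : csmcat) (F : functor C D) :=
  StrongSymmetricMonoidal {
  sm_mul : forall X Y, Hom (F X ⊗ F Y) (F (X ⊗ Y));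
  sm_one : Hom one (F one);
  sm_mul_iso : forall X Y, is_iso (sm_mul X Y);
  sm_one_iso : is_iso sm_one;
  sm_mul_nat : forall X X' Y Y' (f : Hom X X') (g : Hom Y Y'),
    sm_mul X' Y' ∘ (fmap F f ⊠ fmap F g) = fmap F (f ⊠ g) ∘ sm_mul X Y;
  sm_assoc : forall X Y Z,
    fmap F (assoc X Y Z) ∘ sm_mul (X ⊗ Y) Z ∘ (sm_mul X Y ⊠ idm (F Z)) =
    sm_mul X (Y ⊗ Z) ∘ (idm (F X) ⊠ sm_mul Y Z) ∘ assoc (F X) (F Y) (F Z);
  sm_lunit : forall X,
    fmap F (lunit X) ∘ sm_mul one X ∘ (sm_one ⊠ idm (F X)) = lunit (F X);
  sm_runit : forall X,
    fmap F (runit X) ∘ sm_mul X one ∘ (idm (F X) ⊠ sm_one) = runit (F X);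
  sm_sym : forall X Y,
    fmap F (sym X Y) ∘ sm_mul X Y = sm_mul Y X ∘ sym (F X) (F Y)
}.

(* Compatibility of a closed symmetric monoidal structure with a triangulation,
   following Hovey-Palmieri-Strickland, Axiomatic stable homotopy theory,
   Definition A.2.1. *)
Section Compat.
Variables (C : csmcat) (T : triangulation C) (e : forall X Y : C,
  Hom (susp T X ⊗ Y) (susp T (X ⊗ Y))).
Implicit Types W X Y Z : C.

Definition susp_tens_r X Y : Hom (X ⊗ susp T Y) (susp T (X ⊗ Y)) :=
  fmap (susp T) (sym Y X) ∘ e Y X ∘ sym X (susp T Y).

(* Σ hom(W,Y) -> hom(W,ΣY) *)
Definition susp_ihom_r W Y : Hom (susp T (ihom W Y)) (ihom W (susp T Y)) :=
  curry (fmap (susp T) (ev W Y) ∘ e (ihom W Y) W).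

(* Σ hom(ΣX,W) -> hom(X,W): the transpose of
   Σ hom(ΣX,W) ⊗ X ≅ Σ (hom(ΣX,W) ⊗ X) ≅ hom(ΣX,W) ⊗ ΣX -> W. *)
Definition susp_ihom_l X W : Hom (susp T (ihom (susp T X) W)) (ihom X W) :=
  curry (ev (susp T X) W ∘ inv (susp_tens_r (ihom (susp T X) W) X)
         ∘ e (ihom (susp T X) W) X).

Record tt_compatible : Prop := TTCompatible {
  e_nat : forall X X' Y Y' (f : Hom X X') (g : Hom Y Y'),
    e X' Y' ∘ (fmap (susp T) f ⊠ g) = fmap (susp T) (f ⊠ g) ∘ e X Y;
  e_iso : forall X Y, is_iso (e X Y);
  e_runit : forall X, fmap (susp T) (runit X) ∘ e X one = runit (susp T X);
  e_assoc : forall X Y Z,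
    e X (Y ⊗ Z) ∘ assoc (susp T X) Y Z =
    fmap (susp T) (assoc X Y Z) ∘ e (X ⊗ Y) Z ∘ (e X Y ⊠ idm Z);
  tens_dist : forall W X Y Z (f : Hom X Y) (g : Hom Y Z) (h : Hom Z (susp T X)),
    dist f g h ->
    dist (f ⊠ idm W) (g ⊠ idm W) (e X W ∘ (h ⊠ idm W));
  ihom_r_dist : forall W X Y Z (f : Hom X Y) (g : Hom Y Z) (h : Hom Z (susp T X)),
    dist f g h ->
    dist (ihom_r W f) (ihom_r W g) (inv (susp_ihom_r W X) ∘ ihom_r W h);
  (* The rotation of Σ^-1 hom(X,W) --(-h)--> hom(Z,W) -> hom(Y,W) -> hom(X,W);
     the sign disappears in rotating. *)
  ihom_l_dist : forall W X Y Z (f : Hom X Y) (g : Hom Y Z) (h : Hom Z (susp T X)),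
    dist f g h ->
    dist (ihom_l W g) (ihom_l W f)
      (fmap (susp T) (ihom_l W h) ∘ inv (susp_ihom_l X W));
  (* The twist on S^r ⊗ S^s is (-1)^(rs); the case r = s = 1 implies the others. *)
  twist_sign : sym (susp T one) (susp T one) = - idm (susp T one ⊗ susp T one) :> Hom _ _
}.
End Compat.

Record ttcat := TTCat {
  tt_csm :> csmcat;
  tt_tri :> triangulation tt_csm;
  tt_susp_tens : forall X Y : tt_csm,
    Hom (susp tt_tri X ⊗ Y) (susp tt_tri (X ⊗ Y));
  tt_compat : tt_compatible tt_susp_tens
}.

Definition rigidly_compactly_generated (C : ttcat) :=
  compactly_generated C /\ forall x : C, compact x <-> rigid x.

Record geometric_functor (D C : ttcat) := GeometricFunctor {
  gf_fun :> functor D C;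
  gf_monoidal : strong_symmetric_monoidal gf_fun;
  gf_triangulated : triangulated_functor D C gf_fun;
  gf_coproducts : preserves_coproducts gf_fun
}.

Section Geometric.
Variables (D C : ttcat) (f : geometric_functor D C).
Variables (f_low : functor C D) (f_upp : functor D C).
Variables (a1 : adjunction f f_low) (a2 : adjunction f_low f_upp).

Definition omega : C := f_upp one.

(* x ⊗ f_* y -> f_* (f^* x ⊗ y), the transpose of
   f^* (x ⊗ f_* y) ≅ f^* x ⊗ f^* f_* y -> f^* x ⊗ y. *)
Definition proj_map (x : D) (y : C) : Hom (x ⊗ f_low y) (f_low (f x ⊗ y)) :=
  ladj a1 ((idm (f x) ⊠ counit_adj a1 y)
           ∘ inv (sm_mul (gf_monoidal f) x (f_low y))).

(* By the projection formula [proj_map] is invertible, so that [inv] below is a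
   genuine inverse. *)
Definition psi (x : D) : Hom (f x ⊗ omega) (f_upp x) :=
  ladj a2 (runit x ∘ (idm x ⊠ counit_adj a2 one) ∘ inv (proj_map x omega)).

Definition psi_ad (x : D) : Hom (f x) (ihom omega (f_upp x)) := curry (psi x).

Definition Af (x : C) : Prop :=
  compact x /\ forall y : C, compact y -> compact (f_low (x ⊗ y)).

Definition Bf : category := full_sub (Loc C Af).
Definition Gamma_low : functor Bf C := inclusion (Loc C Af).

Variables (Gamma_upp : functor C Bf) (a3 : adjunction Gamma_low Gamma_upp).

Definition low_tens_adj :
    adjunction (f_low ⊙ (tens_right omega ⊙ Gamma_low))
               (Gamma_upp ⊙ ihom_from omega ⊙ f_upp) :=
  adj_comp (adj_comp a3 (tens_hom_adj omega)) a2.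
End Geometric.

(* Main.v *)
From mathcomp Require Import all_boot ssralg.
From mathcomp Require Import boolp classical_sets.
Require Import Defs.

(* By compact generation the projection formula [x ⊗ f_* y ≅ f_*(f^* x ⊗ y)] need
   only be checked for [x] rigid, where both sides represent the functor
   [z => Hom(x^∨ ⊗ z, f_* y)].

   A pairing [q ⊗ p -> ω] induces [f_* q ⊗ f_* p -> f_* ω -> 1].  When one of [f_* q],
   [f_* p] is compact, hence rigid, and the pairing identifies the other factor with
   a dual, the induced pairing is a duality in D, so that
   [Hom(1, x ⊗ f_* q) ≅ Hom(f_* p, x)].  For [a] in [A_f] with dual [a^∨], again in
   [A_f], the pairing [(ω ⊗ a^∨) ⊗ a -> ω] shows that [Hom(a, ψ)] is bijective, and
   [a^∨ ⊗ (a ⊗ ω) -> ω] that [Hom(a, ψ^ad)] is.  Bijectivity then spreads from [A_f] to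
   the localizing subcategory it generates, which is (b) and (c).

   (a) follows because the colocalization is smashing, [Γ_! Γ^* x ≅ x ⊗ Γ_! Γ^* 1], so
   that [Γ^*] has a right adjoint; (d) is the passage of (c) to left adjoints. *)

Set Implicit Arguments.
Unset Strict Implicit.
Unset Printing Implicit Defensive.

Import GRing.Theory.
Local Open Scope ring_scope.
Local Open Scope cat_scope.

(** The isomorphisms in (b) and (c) are the prescribed maps [psi] and [psi_ad], so a chain of
    abstractly isomorphic hom groups does not suffice: each bijection has to be recognised as
    composition with that very map. This is why two explicit composites out of one hom group are
    compared ([eq_bij]) and known bijective factors are cancelled ([bij_compl], [bij_compr]). The
    comparison with D uses the unit as test object, whence the factor [f one] below.

    Suspension is only an equivalence, and localizing subcategories are closed under its inverse as
    well. For the projection formula and for the vanishing of maps, the property is therefore first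
    strengthened to all twists by compact objects; the isomorphism ΣX ⊗ w ≅ X ⊗ Σw then moves a
    suspension onto the test object. The quantifier over [y] in [Af] serves the same purpose.

    For (a), part (b) replaces Γ^* f^! by Γ^*(ω ⊗ f^* -), a composite of functors each of which has
    a right adjoint. *)

Definition bij A B (F : A -> B) := injective F /\ forall y, exists x, F x = y.

Lemma bijP A B (F : A -> B) : bijective F <-> bij F.
Proof.
split=> [[G FK GK]|[Fi Fs]]; first by split; [exact: can_inj FK | move=> y; exists (G y)].
have [G GK] := choice Fs.
by exists G => // x; apply: Fi; rewrite GK.
Qed.

Lemma bij_comp A B D (G : B -> D) (F : A -> B) : bij G -> bij F -> bij (G \o F).
Proof.
move=> [Gi Gs] [Fi Fs]; split; first exact: inj_comp.
by move=> z; have [y <-] := Gs z; have [x <-] := Fs y; exists x.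
Qed.

Lemma eq_bij A B (F G : A -> B) : F =1 G -> bij F -> bij G.
Proof. by move=> /funext ->. Qed.

(** With [bij_comp] and [bij_compl] this is two out of three for bijections: the unknown map is
    composed with known ones until the composite is visibly bijective, and the known ones are then
    cancelled. *)
Lemma bij_compr A B D (G : B -> D) (F : A -> B) : bij (G \o F) -> bij F -> bij G.
Proof.
move=> [GFi GFs] [Fi Fs]; split=> [y y'|z]; last first.
  by have [x <-] := GFs z; exists (F x).
by have [x <-] := Fs y; have [x' <-] := Fs y' => /GFi ->.
Qed.

Lemma bij_compl A B D (G : B -> D) (F : A -> B) : bij (G \o F) -> bij G -> bij F.
Proof.
move=> [GFi GFs] [Gi Gs]; split=> [x x' E|y]; first by apply: GFi => /=; rewrite E.
by have [x Ex] := GFs (G y); exists x; apply: Gi.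
Qed.

(** * Preadditive categories: isomorphisms, zero objects, coproducts, compact objects *)

Section CategoryTheory.
Variable C : category.
Implicit Types W X Y Z : C.

Lemma comp0m X Y Z (f : Hom X Y) : (0 : Hom Y Z) ∘ f = 0.
Proof. by apply: (@addrI _ (0 ∘ f)); rewrite -compDl !addr0. Qed.
Lemma compm0 X Y Z (g : Hom Y Z) : g ∘ (0 : Hom X Y) = 0.
Proof. by apply: (@addrI _ (g ∘ 0)); rewrite -compDr !addr0. Qed.
Lemma compNm X Y Z (g : Hom Y Z) (f : Hom X Y) : (- g) ∘ f = - (g ∘ f).
Proof. by apply/eqP; rewrite -addr_eq0 -compDl addNr comp0m. Qed.
Lemma compmN X Y Z (g : Hom Y Z) (f : Hom X Y) : g ∘ (- f) = - (g ∘ f).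
Proof. by apply/eqP; rewrite -addr_eq0 -compDr addNr compm0. Qed.
Lemma compBm X Y Z (g g' : Hom Y Z) (f : Hom X Y) : (g - g') ∘ f = g ∘ f - g' ∘ f.
Proof. by rewrite compDl compNm. Qed.
Lemma compmB X Y Z (g : Hom Y Z) (f f' : Hom X Y) : g ∘ (f - f') = g ∘ f - g ∘ f'.
Proof. by rewrite compDr compmN. Qed.
Lemma comp_suml n X Y Z (g : 'I_n -> Hom Y Z) (f : Hom X Y) :
  (\sum_(k < n) g k) ∘ f = \sum_(k < n) (g k ∘ f).
Proof.
by apply: (big_morph (fun h => h ∘ f)) => [h h'|]; rewrite ?compDl ?comp0m.
Qed.
Lemma comp_sumr n X Y Z (g : Hom Y Z) (f : 'I_n -> Hom X Y) :
  g ∘ (\sum_(k < n) f k) = \sum_(k < n) (g ∘ f k).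
Proof.
by apply: (big_morph (fun h => g ∘ h)) => [h h'|]; rewrite ?compDr ?compm0.
Qed.

(* Reassociation: lets an equation between composites be rewritten inside a
   right-nested chain. *)
Lemma reas X Y Y' Z (g : Hom Y Z) (f : Hom X Y) (g' : Hom Y' Z) (f' : Hom X Y') :
  g ∘ f = g' ∘ f' -> forall W (k : Hom W X), g ∘ (f ∘ k) = g' ∘ (f' ∘ k).
Proof. by move=> E W k; rewrite !compA E. Qed.
Lemma reas1 X Y Z (g : Hom Y Z) (f : Hom X Y) (h : Hom X Z) :
  g ∘ f = h -> forall W (k : Hom W X), g ∘ (f ∘ k) = h ∘ k.
Proof. by move=> E W k; rewrite compA E. Qed.
Lemma reasV X Y (f : Hom X Y) (g : Hom Y X) :
  f ∘ g = idm Y -> forall W (k : Hom W Y), f ∘ (g ∘ k) = k.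
Proof. by move=> E W k; rewrite compA E comp1m. Qed.

Lemma invP X Y (f : Hom X Y) : is_iso f -> is_inverse f (inv f).
Proof. by move=> [g Hg]; apply: (@xgetPex _ 0 [set h | is_inverse f h]); exists g. Qed.
Lemma invK X Y (f : Hom X Y) : is_iso f -> inv f ∘ f = idm X.
Proof. by move=> /invP[]. Qed.
Lemma Kinv X Y (f : Hom X Y) : is_iso f -> f ∘ inv f = idm Y.
Proof. by move=> /invP[]. Qed.
Lemma iso_inv X Y (f : Hom X Y) : is_iso f -> is_iso (inv f).
Proof. by move=> If; exists f; split; [exact: Kinv | exact: invK]. Qed.
Lemma iso_id X : is_iso (idm X).
Proof. by exists (idm X); split; rewrite comp1m. Qed.
Lemma iso_comp X Y Z (g : Hom Y Z) (f : Hom X Y) :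
  is_iso g -> is_iso f -> is_iso (g ∘ f).
Proof.
move=> [g' [g'g gg']] [f' [f'f ff']]; exists (f' ∘ g').
by split; rewrite -compA ?(reasV g'g) ?(reasV ff').
Qed.
Lemma iso_mono X Y (f : Hom X Y) : is_iso f ->
  forall Z (u v : Hom Z X), f ∘ u = f ∘ v -> u = v.
Proof. by move=> If Z u v E; rewrite -[u](reasV (invK If)) E (reasV (invK If)). Qed.
Lemma iso_epi X Y (f : Hom X Y) : is_iso f ->
  forall Z (u v : Hom Y Z), u ∘ f = v ∘ f -> u = v.
Proof.
by move=> If Z u v E; rewrite -[u]compm1 -[v]compm1 -(Kinv If) !compA E.
Qed.
Lemma iso_cancel_l X Y Z (g : Hom Y Z) (f : Hom X Y) :
  is_iso g -> is_iso (g ∘ f) -> is_iso f.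
Proof.
move=> Ig Igf; rewrite -[f](reasV (invK Ig)); apply: iso_comp => //; exact: iso_inv.
Qed.
Lemma iso_cancel_r X Y Z (g : Hom Y Z) (f : Hom X Y) :
  is_iso f -> is_iso (g ∘ f) -> is_iso g.
Proof.
move=> If Igf; rewrite -[g]compm1 -(Kinv If) compA; apply: iso_comp => //.
exact: iso_inv.
Qed.

Lemma iso_bij_l X Y (f : Hom X Y) Z : is_iso f -> bij (fun u : Hom Z X => f ∘ u).
Proof.
move=> If; split; first by move=> u v; exact: iso_mono.
by move=> v; exists (inv f ∘ v); rewrite (reasV (Kinv If)).
Qed.
Lemma iso_bij_r X Y (f : Hom X Y) Z : is_iso f -> bij (fun u : Hom Y Z => u ∘ f).
Proof.
move=> If; split; first by move=> u v; exact: iso_epi.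
by move=> v; exists (v ∘ inv f); rewrite -compA invK // compm1.
Qed.
Lemma yoneda_iso X Y (f : Hom X Y) :
  (forall Z, bij (fun u : Hom Z X => f ∘ u)) -> is_iso f.
Proof.
move=> H; have [g fg] := (H Y).2 (idm Y); exists g; split=> //.
by apply: (H X).1; rewrite compA fg comp1m compm1.
Qed.

Lemma zero_of_id Z : idm Z = 0 -> is_zero Z.
Proof.
by move=> E; split=> X f; [rewrite -[f]comp1m E comp0m | rewrite -[f]compm1 E compm0].
Qed.
Lemma zero_retract X Y (f : Hom X Y) (g : Hom Y X) :
  g ∘ f = idm X -> is_zero Y -> is_zero X.
Proof.
by move=> gf [Y0 _]; apply: zero_of_id; rewrite -gf (Y0 _ f) compm0.
Qed.
Lemma zero_iso X Y (f : Hom X Y) : is_iso f -> is_zero X -> is_zero Y.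
Proof. by move=> If; apply: (@zero_retract _ _ (inv f) f); exact: Kinv. Qed.

Lemma coprod_ext (I : small) (y : I -> C) Y (inj : forall i, Hom (y i) Y) :
  is_coprod inj -> forall Z (u v : Hom Y Z),
  (forall i, u ∘ inj i = v ∘ inj i) -> u = v.
Proof.
move=> H Z u v E; have [w [_ Hw]] := H Z (fun i => v ∘ inj i).
by rewrite -(Hw u E) -(Hw v (fun=> erefl)).
Qed.
Lemma coprod_zero (I : small) (y : I -> C) Y (inj : forall i, Hom (y i) Y) :
  is_coprod inj -> (forall i, is_zero (y i)) -> is_zero Y.
Proof.
move=> H H0; apply: zero_of_id; apply: (coprod_ext H) => i.
by rewrite ((H0 i).2 _ (idm Y ∘ _)) ((H0 i).2 _ (0 ∘ _)).
Qed.
Lemma coprod_map_iso (I : small) (y y' : I -> C) Y Y'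
    (inj : forall i, Hom (y i) Y) (inj' : forall i, Hom (y' i) Y')
    (t : forall i, Hom (y i) (y' i)) (u : Hom Y Y') :
  is_coprod inj -> is_coprod inj' -> (forall i, is_iso (t i)) ->
  (forall i, u ∘ inj i = inj' i ∘ t i) -> is_iso u.
Proof.
move=> H H' It Hu; have [v [Hv _]] := H' Y (fun i => inj i ∘ inv (t i)).
exists v; split.
  apply: (coprod_ext H) => i.
  by rewrite -compA Hu compA Hv -compA invK // compm1 comp1m.
apply: (coprod_ext H') => i.
by rewrite -compA Hv compA Hu -compA Kinv // compm1 comp1m.
Qed.

Lemma compact_retract X Y (s : Hom Y X) (r : Hom X Y) :
  r ∘ s = idm Y -> compact X -> compact Y.
Proof.
move=> rs cX I y Z inj H; have [Hs Hi] := cX I y Z inj H; split=> [h|n t g ti E].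
  have [n [t [g [ti E]]]] := Hs (h ∘ r); exists n, t, (fun k => g k ∘ s); split=> //.
  rewrite -[h]compm1 -rs compA E comp_suml; apply: eq_bigr => k _.
  by rewrite compA.
move=> k; rewrite -[g k]compm1 -rs compA (Hi n t (fun k => g k ∘ r)) ?comp0m //.
by under eq_bigr do rewrite compA; rewrite -comp_suml E comp0m.
Qed.
Lemma compact_iso X Y (f : Hom X Y) : is_iso f -> compact X -> compact Y.
Proof. by move=> If; apply: (@compact_retract _ _ (inv f) f); exact: Kinv. Qed.
Lemma compact_isoV X Y (f : Hom X Y) : is_iso f -> compact Y -> compact X.
Proof. by move=> If; apply: (@compact_retract _ _ f (inv f)); exact: invK. Qed.
End CategoryTheory.

Lemma fmap_iso (C D : category) (F : functor C D) X Y (f : Hom X Y) :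
  is_iso f -> is_iso (fmap F f).
Proof.
by move=> [g [gf fg]]; exists (fmap F g); split; rewrite -fmapM ?gf ?fg fmap1.
Qed.
Lemma fmap_inv (C D : category) (F : functor C D) X Y (f : Hom X Y) :
  is_iso f -> fmap F (inv f) ∘ fmap F f = idm _.
Proof. by move=> If; rewrite -fmapM invK // fmap1. Qed.
Lemma add_fmap0 (C D : category) (F : functor C D) X Y :
  additive_functor F -> fmap F (0 : Hom X Y) = 0.
Proof.
by move=> H; apply: (@addrI _ (fmap F 0)); rewrite -H !addr0.
Qed.
Lemma add_fmapN (C D : category) (F : functor C D) X Y (f : Hom X Y) :
  additive_functor F -> fmap F (- f) = - fmap F f.
Proof.
by move=> H; apply/eqP; rewrite -addr_eq0 -H addNr add_fmap0.
Qed.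
Lemma add_fmap_sum (C D : category) (F : functor C D) X Y n (f : 'I_n -> Hom X Y) :
  additive_functor F -> fmap F (\sum_(k < n) f k) = \sum_(k < n) fmap F (f k).
Proof.
move=> H; apply: (big_morph (fun h => fmap F h)) => [h h'|]; first exact: H.
exact: add_fmap0.
Qed.
Lemma add_fmap_zero (C D : category) (F : functor C D) X :
  additive_functor F -> is_zero X -> is_zero (F X).
Proof.
move=> H [X0 _]; apply: zero_of_id.
by rewrite -fmap1 (X0 _ (idm X)) add_fmap0.
Qed.

Lemma natural_iso_inv (C D : category) (F G : functor C D)
    (eta : forall X, Hom (F X) (G X)) :
  natural_iso F G eta -> natural_iso G F (fun X => inv (eta X)).
Proof.
move=> [N I]; split=> [X Y f|X]; last by apply: iso_inv.
apply: (iso_mono (I Y)); apply: (iso_epi (I X)).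
by rewrite -!compA (reasV (Kinv (I Y))) invK // compm1 N.
Qed.

(** * Adjunctions, their transport along natural isomorphisms, and mates *)

Section Adjunctions.
Variables (C D : category) (L : functor C D) (R : functor D C) (a : adjunction L R).

Lemma radjK X Y (f : Hom (L X) Y) : radj a (ladj a f) = f.
Proof.
by rewrite /radj /ladj fmapM compA (counit_adj_nat a) -compA adj_triL compm1.
Qed.
Lemma ladjK X Y (g : Hom X (R Y)) : ladj a (radj a g) = g.
Proof.
by rewrite /radj /ladj fmapM -compA -(unit_adj_nat a) compA adj_triR comp1m.
Qed.
Lemma radj_inj X Y : injective (@radj _ _ _ _ a X Y).
Proof. exact: can_inj (@ladjK X Y). Qed.
Lemma ladj_inj X Y : injective (@ladj _ _ _ _ a X Y).
Proof. exact: can_inj (@radjK X Y). Qed.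
Lemma bij_radj X Y : bij (@radj _ _ _ _ a X Y).
Proof. by apply/bijP; exists (@ladj _ _ _ _ a X Y); [exact: ladjK | exact: radjK]. Qed.
Lemma radj_comp X X' Y (g : Hom X (R Y)) (u : Hom X' X) :
  radj a (g ∘ u) = radj a g ∘ fmap L u.
Proof. by rewrite /radj fmapM compA. Qed.
Lemma radj_post X Y Y' (g : Hom X (R Y)) (v : Hom Y Y') :
  radj a (fmap R v ∘ g) = v ∘ radj a g.
Proof. by rewrite /radj fmapM compA (counit_adj_nat a) compA. Qed.
Lemma ladj_post X Y Y' (g : Hom (L X) Y) (v : Hom Y Y') :
  fmap R v ∘ ladj a g = ladj a (v ∘ g).
Proof. by rewrite /ladj fmapM compA. Qed.
Lemma ladj_comp X X' Y (g : Hom (L X) Y) (u : Hom X' X) :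
  ladj a g ∘ u = ladj a (g ∘ fmap L u).
Proof. by rewrite /ladj fmapM -!compA (unit_adj_nat a). Qed.

Lemma left_adjoint_coproducts : preserves_coproducts L.
Proof.
move=> I y Y inj H Z h; have [u [Hu Uu]] := H (R Z) (fun i => ladj a (h i)).
exists (radj a u); split=> [i|v Hv]; first by rewrite -radj_comp Hu radjK.
rewrite -[v]radjK; congr radj; apply: Uu => i.
by rewrite ladj_comp Hv.
Qed.

(** Maps out of [L X] transpose to maps out of [X] into the coproduct [R Y]; additivity of [L] lets
    the finite sums be transposed termwise. *)
Lemma left_adjoint_compact X :
  additive_functor L -> preserves_coproducts R -> compact X -> compact (L X).
Proof.
move=> addL HR cX I y Y inj H; have [Hs Hi] := cX I _ _ _ (HR _ _ _ _ H).
have radj_sum n (s : 'I_n -> I) (g : forall k, Hom X (R (y (s k)))) :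
    radj a (\sum_(k < n) fmap R (inj (s k)) ∘ g k)
    = \sum_(k < n) inj (s k) ∘ radj a (g k).
  rewrite /radj (add_fmap_sum _ addL) comp_sumr; apply: eq_bigr => k _.
  by rewrite fmapM compA (counit_adj_nat a) -compA.
have radj0 Z Z' : radj a (0 : Hom Z (R Z')) = 0.
  by rewrite /radj (add_fmap0 _ _ addL) compm0.
split=> [h|n s g si E].
  have [n [s [g [si E]]]] := Hs (ladj a h).
  by exists n, s, (fun k => radj a (g k)); rewrite -radj_sum -E radjK.
have E' : \sum_(k < n) fmap R (inj (s k)) ∘ ladj a (g k) = 0.
  apply: radj_inj; rewrite radj_sum radj0 -[RHS]E.
  by apply: eq_bigr => k' _; rewrite radjK.
by move=> k; rewrite -[g k]radjK (Hi n s (fun k => ladj a (g k)) si E') radj0.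
Qed.

Lemma right_adjoint_additive : additive_functor L -> additive_functor R.
Proof.
move=> addL X Y f g; apply: radj_inj.
by rewrite /radj (counit_adj_nat a) addL compDr !(counit_adj_nat a) compDl.
Qed.
End Adjunctions.

Section AdjunctionTransport.
Variables (C D : category).

Lemma adjunction_iso_left (L L' : functor C D) (R : functor D C)
    (eta : forall X, Hom (L X) (L' X)) :
  natural_iso L L' eta -> adjunction L R -> adjunction L' R.
Proof.
move=> [N I] a.
have N' X Y (f : Hom X Y) : inv (eta Y) ∘ fmap L' f = fmap L f ∘ inv (eta X).
  exact: (natural_iso_inv (conj N I)).1.
apply: (@Adjunction _ _ _ _ (fun X => fmap R (eta X) ∘ unit_adj a X)
  (fun Y => counit_adj a Y ∘ inv (eta (R Y)))) => [X X' f|Y Y' g|X|Y].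
- by rewrite -compA (unit_adj_nat a) !compA -!fmapM N.
- by rewrite -compA N' compA (counit_adj_nat a) compA.
- rewrite -compA N' fmapM compA [counit_adj _ _ ∘ _]compA (counit_adj_nat a).
  by rewrite -[eta X ∘ _ ∘ _]compA adj_triL compm1 Kinv.
- by rewrite fmapM -compA [fmap R (inv _) ∘ _]compA -fmapM invK // fmap1 comp1m adj_triR.
Qed.

Lemma adjunction_iso_right (L : functor C D) (R R' : functor D C)
    (eta : forall X, Hom (R X) (R' X)) :
  natural_iso R R' eta -> adjunction L R -> adjunction L R'.
Proof.
move=> [N I] a.
have N' X Y (f : Hom X Y) : inv (eta Y) ∘ fmap R' f = fmap R f ∘ inv (eta X).
  exact: (natural_iso_inv (conj N I)).1.
apply: (@Adjunction _ _ _ _ (fun X => eta (L X) ∘ unit_adj a X)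
  (fun Y => counit_adj a Y ∘ fmap L (inv (eta Y)))) => [X X' f|Y Y' g|X|Y].
- by rewrite -compA (unit_adj_nat a) !compA N.
- by rewrite -compA -fmapM N' fmapM compA (counit_adj_nat a) compA.
- by rewrite -compA -fmapM compA invK // comp1m adj_triL.
- rewrite fmapM -!compA !(reas (esym (N _ _ _))) -(unit_adj_nat a).
  by rewrite (reasV (adj_triR a Y)) Kinv.
Qed.

Lemma left_mate_iso (L1 L2 : functor C D) (R1 R2 : functor D C)
    (a1 : adjunction L1 R1) (a2 : adjunction L2 R2)
    (theta : forall Y, Hom (R1 Y) (R2 Y)) :
  natural_iso R1 R2 theta -> natural_iso L2 L1 (left_mate a1 a2 theta).
Proof.
(* Passage to mates reverses composition, so a one-sided inverse of transformations gives a
   one-sided inverse of mates; it is used twice, with the roles exchanged. *)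
have mateM (L L' : functor C D) (R R' : functor D C) (a : adjunction L R)
    (a' : adjunction L' R') (t : forall Y, Hom (R Y) (R' Y))
    (t' : forall Y, Hom (R' Y) (R Y)) X :
    natural R' R t' -> (forall Y, t' Y ∘ t Y = idm _) ->
    left_mate a a' t X ∘ left_mate a' a t' X = idm (L X).
  move=> N' K; apply: (ladj_inj (a := a)); rewrite -ladj_post {2}/left_mate ladjK.
  rewrite compA -N' -compA -[fmap R' _ ∘ _]/(ladj a' _) /left_mate ladjK.
  by rewrite (reasV (K _)) /ladj fmap1 comp1m.
move=> NI; have [N' I'] := natural_iso_inv NI; have [N I] := NI; split.
  move=> X Y f; rewrite /left_mate -radj_comp -radj_post; congr radj.
  by rewrite -compA (unit_adj_nat a1) !compA N.
move=> X; exists (left_mate a2 a1 (fun Y => inv (theta Y)) X).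
by split; apply: mateM => // Y; [exact: Kinv | exact: invK].
Qed.
End AdjunctionTransport.

(** Applied to the suspension, whose quasi-inverse is only known to exist: [R] is both a left and a
    right adjoint, so both functors preserve coproducts and compact objects. *)
Lemma equivalence_adjoints (C D : category) (F : functor C D) :
  fully_faithful F -> essentially_surjective F ->
  exists R : functor D C, (forall Y, exists f : Hom (F (R Y)) Y, is_iso f) /\
    inhabited (adjunction F R) /\ inhabited (adjunction R F).
Proof.
move=> FF ES; pose r Y := projT1 (cid (ES Y)).
pose e Y : Hom (F (r Y)) Y := projT1 (cid (projT2 (cid (ES Y)))).
have Ie Y : is_iso (e Y) := projT2 (cid (projT2 (cid (ES Y)))).
have faith X Y (f g : Hom X Y) : fmap F f = fmap F g -> f = g := fun E => bij_inj (FF X Y) E.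
have full X Y (g : Hom (F X) (F Y)) : exists f, fmap F f = g.
  by have [h _ hK] := FF X Y; exists (h g); apply: hK.
pose l X Y (g : Hom (F X) (F Y)) : Hom X Y := projT1 (cid (full X Y g)).
have lK X Y (g : Hom (F X) (F Y)) : fmap F (l X Y g) = g := projT2 (cid (full X Y g)).
have R1 X : l _ _ (inv (e X) ∘ (idm X ∘ e X)) = idm (r X).
  by apply: faith; rewrite lK comp1m invK // fmap1.
have RM X Y Z (g : Hom Y Z) (f : Hom X Y) :
    l _ _ (inv (e Z) ∘ (g ∘ f ∘ e X))
    = l _ _ (inv (e Z) ∘ (g ∘ e Y)) ∘ l _ _ (inv (e Y) ∘ (f ∘ e X)).
  by apply: faith; rewrite fmapM !lK -!compA (reasV (Kinv (Ie Y))).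
pose R : functor D C :=
  @Functor D C r (fun X Y f => l _ _ (inv (e Y) ∘ (f ∘ e X))) R1 RM.
have FR X Y (f : Hom X Y) : fmap F (fmap R f) = inv (e Y) ∘ (f ∘ e X) by apply: lK.
exists R; split; first by move=> Y; exists (e Y).
split; constructor.
  apply: (@Adjunction _ _ F R (fun X => l X (r (F X)) (inv (e (F X)))) e) => *.
  - by apply: faith; rewrite !fmapM FR !lK -!compA Kinv // compm1.
  - by rewrite FR (reasV (Kinv (Ie _))).
  - by rewrite lK Kinv.
  - by apply: faith; rewrite fmapM FR lK -!compA Kinv // compm1 invK // fmap1.
apply: (@Adjunction _ _ R F (fun Y => inv (e Y)) (fun X => l (r (F X)) X (e (F X)))) => *.
- by rewrite FR -!compA Kinv // compm1.
- by apply: faith; rewrite !fmapM FR !lK (reasV (Kinv (Ie _))).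
- by apply: faith; rewrite fmapM FR lK (reasV (Kinv (Ie _))) invK // fmap1.
- by rewrite lK Kinv.
Qed.
(** The five lemma for plain functions between groups; additivity is recorded as compatibility with
    differences, the form in which the chase uses it. *)
Lemma five_bij (A1 A2 A3 A4 A5 B1 B2 B3 B4 B5 : zmodType)
    (a1 : A1 -> A2) (a2 : A2 -> A3) (a3 : A3 -> A4) (a4 : A4 -> A5)
    (b1 : B1 -> B2) (b2 : B2 -> B3) (b3 : B3 -> B4) (b4 : B4 -> B5)
    (t1 : A1 -> B1) (t2 : A2 -> B2) (t3 : A3 -> B3) (t4 : A4 -> B4) (t5 : A5 -> B5) :
  (forall x y, a2 (x - y) = a2 x - a2 y) -> (forall x y, b3 (x - y) = b3 x - b3 y) ->
  (forall x y, t3 (x - y) = t3 x - t3 y) ->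
  (forall x, t2 (a1 x) = b1 (t1 x)) -> (forall x, t3 (a2 x) = b2 (t2 x)) ->
  (forall x, t4 (a3 x) = b3 (t3 x)) -> (forall x, t5 (a4 x) = b4 (t4 x)) ->
  (forall x, a2 (a1 x) = 0) -> (forall x, b4 (b3 x) = 0) ->
  (forall x, a3 x = 0 -> exists z, x = a2 z) -> (forall x, a4 x = 0 -> exists z, x = a3 z) ->
  (forall x, b2 x = 0 -> exists z, x = b1 z) -> (forall x, b3 x = 0 -> exists z, x = b2 z) ->
  bij t1 -> bij t2 -> bij t4 -> bij t5 -> t4 0 = 0 -> t5 0 = 0 -> bij t3.
Proof.
move=> a2B b3B t3B N1 N2 N3 N4 a21 b43 exA3 exA4 exB2 exB3.
move=> [_ t1s] [t2i t2s] [t4i t4s] [t5i _] t40 t50; split=> [x y E|y].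
  apply/eqP; rewrite -subr_eq0; apply/eqP; move: (x - y) (t3B x y).
  rewrite {}E subrr => {x y} x E.
  have E3 : a3 x = 0 by apply: t4i; rewrite N3 E t40 -(subrr 0) b3B subrr.
  have [x2 Ex] := exA3 _ E3; have [z Ez] : exists z, t2 x2 = b1 z.
    by apply: exB2; rewrite -N2 -Ex.
  have [x1 Ex1] := t1s z; rewrite Ex; suff -> : x2 = a1 x1 by [].
  by apply: t2i; rewrite Ez N1 Ex1.
have [x4 E4] := t4s (b3 y); have [x3 E3] : exists z, x4 = a3 z.
  by apply: exA4; apply: t5i; rewrite N4 E4 b43 t50.
have [z Ez] : exists z, y - t3 x3 = b2 z.
  by apply: exB3; rewrite b3B -N3 -E3 E4 subrr.
(* The preimage is [x3 + a2 x2], written as a difference because the hypotheses speak of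
   differences. *)
have [x2 E2] := t2s z; exists (x3 - a2 (- x2)); rewrite t3B.
have -> : a2 (- x2) = - a2 x2 by rewrite -[- x2]sub0r a2B -(subrr 0) a2B subrr sub0r.
have -> : t3 (- a2 x2) = - t3 (a2 x2).
  by rewrite -[- a2 x2]sub0r t3B -(subrr 0) t3B subrr sub0r.
by rewrite opprK N2 E2 -Ez addrC subrK.
Qed.

(** * Triangulated categories *)

Section Triangulated.
Variables (C : category) (T : triangulation C).
Implicit Types W X Y Z : C.
Notation "'Σ' X" := (susp T X) (at level 10, X at level 9).
Notation "'Σm' f" := (fmap (susp T) f) (at level 10, f at level 9).

Lemma susp_inj X Y (f g : Hom X Y) : Σm f = Σm g -> f = g.
Proof. by move=> E; exact: (bij_inj (susp_ff T X Y) E). Qed.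
Lemma susp_full X Y (g : Hom (Σ X) (Σ Y)) : exists f, g = Σm f.
Proof. by have [h _ hK] := susp_ff T X Y; exists (h g). Qed.
Lemma susp_zero X : is_zero X -> is_zero (Σ X).
Proof. by apply: add_fmap_zero; exact: (susp_add T). Qed.
Lemma zero_susp X : is_zero (Σ X) -> is_zero X.
Proof.
move=> [X0 _]; apply: zero_of_id; apply: susp_inj.
by rewrite (X0 _ (fmap _ _)) [RHS]X0.
Qed.

(** A map from the triangle X = X -> 0 to the given one factors [g ∘ f] through a zero object. *)
Lemma dist_comp0 X Y Z (f : Hom X Y) (g : Hom Y Z) (h : Hom Z (Σ X)) :
  dist f g h -> g ∘ f = 0.
Proof.
move=> H; have [O HO] := zero_ex T.
have [|c [Hc _]] := dist_fill (a := idm X) (b := f) (dist_id T X HO) H.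
  by rewrite !compm1.
by rewrite -Hc compm0.
Qed.

(** A map from the rotated triangle W -> 0 -> ΣW to the rotated given one has as third component the
    suspension of the lift; the two signs from rotation cancel. *)
Lemma dist_exact X Y Z (f : Hom X Y) (g : Hom Y Z) (h : Hom Z (Σ X)) :
  dist f g h -> forall W (u : Hom W Y), g ∘ u = 0 -> exists v, u = f ∘ v.
Proof.
move=> /(dist_rot f g h) H W u gu; have [O HO] := zero_ex T.
have HW := (dist_rot _ _ _).1 (dist_id T W HO).
have [|c [_ Hc]] := dist_fill (a := u) (b := 0) HW H; first by rewrite gu compm0.
have [v Ev] := susp_full c; exists v; apply: susp_inj; rewrite fmapM -Ev.
by apply: oppr_inj; rewrite -compNm -Hc fmap1 compmN compm1.
Qed.

Lemma dist_coexact X Y Z (f : Hom X Y) (g : Hom Y Z) (h : Hom Z (Σ X)) :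
  dist f g h -> forall W (u : Hom Y W), u ∘ f = 0 -> exists v, u = v ∘ g.
Proof.
move=> H W u uf; have [O HO] := zero_ex T.
have HW : dist (0 : Hom O W) (idm W) (0 : Hom W (Σ O)).
  apply/dist_rot; rewrite (add_fmap0 _ _ (susp_add T)) oppr0.
  by apply: dist_id; exact: susp_zero.
have [|c [Hc _]] := dist_fill (a := 0) (b := u) H HW; first by rewrite uf compm0.
by exists c; rewrite Hc comp1m.
Qed.

Lemma dist_exact_susp X Y Z (f : Hom X Y) (g : Hom Y Z) (h : Hom Z (Σ X)) :
  dist f g h -> forall W (u : Hom W (Σ X)), Σm f ∘ u = 0 -> exists v, u = h ∘ v.
Proof.
move=> /dist_rot/dist_rot H W u E; apply: (dist_exact H).
by rewrite compNm E oppr0.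
Qed.

Lemma cone_vanish X Y Z (f : Hom X Y) (g : Hom Y Z) (h : Hom Z (Σ X)) W W'
    (e : Hom (Σ W') W) : is_iso e -> dist f g h ->
  (forall v : Hom W Y, exists u, f ∘ u = v) ->
  (forall u : Hom W' X, f ∘ u = 0 -> u = 0) ->
  forall k : Hom W Z, k = 0.
Proof.
move=> Ie H Hs Hi k; have [u Eu] := susp_full (h ∘ k ∘ e).
have hk : h ∘ k = 0.
  apply: (iso_epi Ie); rewrite Eu comp0m (Hi u) ?(add_fmap0 _ _ (susp_add T)) //.
  apply: susp_inj; rewrite fmapM -Eu (add_fmap0 _ _ (susp_add T)).
  have E : Σm f ∘ h = 0.
    by apply: oppr_inj; rewrite -compNm oppr0; have /dist_rot/dist_rot/dist_comp0 := H.
  by rewrite -!compA (reas1 E) comp0m.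
have [v Ev] := dist_exact ((dist_rot _ _ _).1 H) hk.
by have [u' Eu'] := Hs v; rewrite Ev -Eu' compA (dist_comp0 H) comp0m.
Qed.

Lemma cone_bij X Y Z (f : Hom X Y) (g : Hom Y Z) (h : Hom Z (Σ X)) W :
  dist f g h -> (forall k : Hom W Z, k = 0) -> (forall k : Hom (Σ W) Z, k = 0) ->
  bij (fun u : Hom W X => f ∘ u).
Proof.
move=> H H0 H1; split=> [u v E|v]; last first.
  by have [|u ->] := dist_exact H (u := v); [exact: H0 | exists u].
apply/eqP; rewrite -subr_eq0; apply/eqP; apply: susp_inj.
have [|w ->] := dist_exact_susp H (u := Σm (u - v)).
  by rewrite -fmapM compmB E subrr (add_fmap0 _ _ (susp_add T)).
by rewrite (H1 w) compm0 (add_fmap0 _ _ (susp_add T)).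
Qed.

Lemma cone_zero_iso X Y Z (f : Hom X Y) (g : Hom Y Z) (h : Hom Z (Σ X)) :
  dist f g h -> is_zero Z -> is_iso f.
Proof.
by move=> H [Z0 _]; apply: yoneda_iso => W; apply: (cone_bij H) => k; exact: Z0.
Qed.

Lemma dist_zero3 X Y Z (f : Hom X Y) (g : Hom Y Z) (h : Hom Z (Σ X)) :
  dist f g h -> is_zero X -> is_zero Y -> is_zero Z.
Proof.
move=> H X0 Y0; apply: zero_of_id.
have [|v ->] := dist_exact ((dist_rot _ _ _).1 H) (u := idm Z).
  exact: (susp_zero X0).1.
by rewrite (Y0.1 _ v) compm0.
Qed.

Lemma desusp_ex X : exists (Y : C) (e : Hom (Σ Y) X), is_iso e.
Proof. exact: susp_es. Qed.

Lemma compact_susp X : compact X <-> compact (Σ X).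
Proof.
have [R [HR [[a] [b]]]] := equivalence_adjoints (susp_ff T) (susp_es T); split=> cX.
  by apply: (left_adjoint_compact a) => //; [exact: (susp_add T) | exact: left_adjoint_coproducts b].
(* [R (Σ X)] is compact, and the isomorphism Σ R Σ X ≅ Σ X lifts through Σ to R Σ X ≅ X. *)
have [e Ie] := HR (Σ X); have [f Ef] := susp_full e.
have If : is_iso f.
  have [g [ge eg]] := Ie; have [g' Eg'] := susp_full g.
  by exists g'; split; apply: susp_inj; rewrite fmapM -Ef -Eg' ?ge ?eg fmap1.
apply: (compact_iso If); apply: (left_adjoint_compact b) => //.
  by apply: (right_adjoint_additive a); exact: (susp_add T).
exact: left_adjoint_coproducts a.
Qed.
Lemma compact_desusp X Y (e : Hom (Σ Y) X) : is_iso e -> compact X -> compact Y.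
Proof. by move=> Ie cX; apply/compact_susp; exact: compact_isoV Ie cX. Qed.

Section Localizing.
Variables (P : C -> Prop) (LP : is_localizing T P).

(** A zero object is a coproduct of the empty family. *)
Lemma loc_zero Z : is_zero Z -> P Z.
Proof.
move=> HZ; apply: (@loc_coprod _ _ _ LP void (fun i : void => match i with end) Z
  (fun i : void => match i with end)) => [W h|[]].
by exists 0; split=> [[]|u _]; rewrite (HZ.2 _ u).
Qed.
(** Closure under isomorphism is not an axiom of [is_localizing]; it holds because [Y] is a cone of
    0 -> X. *)
Lemma loc_iso X Y (f : Hom X Y) : is_iso f -> P X -> P Y.
Proof.
move=> If PX; have [O HO] := zero_ex T.
have H : dist (0 : Hom O X) (idm X) (0 : Hom X (Σ O)).
  apply/dist_rot; rewrite (add_fmap0 _ _ (susp_add T)) oppr0.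
  by apply: dist_id; exact: susp_zero.
have H' : dist (0 : Hom O X) f (0 : Hom Y (Σ O)).
  apply: (dist_iso (iso_id O) (iso_id X) If _ _ _ H).
  - by rewrite comp1m compm1.
  - by rewrite compm1.
  - by rewrite fmap1 comp1m comp0m.
by apply: (loc_dist LP H'); first exact: loc_zero.
Qed.
Lemma loc_desusp X Y (e : Hom (Σ Y) X) : is_iso e -> P X -> P Y.
Proof. by move=> Ie PX; apply/(loc_susp LP); apply: loc_iso PX; exact: iso_inv Ie. Qed.
End Localizing.

Lemma Loc_localizing (A : C -> Prop) : is_localizing T (Loc T A).
Proof.
split=> [X|X Y Z f g h H HX HY|I y Y inj H Hy].
- split=> H P LP AP; first by apply: (loc_susp LP X).1; exact: H.
  by apply: (loc_susp LP X).2; exact: H.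
- by move=> P LP AP; apply: (loc_dist LP H); [exact: HX | exact: HY].
- by move=> P LP AP; apply: (loc_coprod LP H) => i; exact: Hy.
Qed.
Lemma Loc_sub (A : C -> Prop) X : A X -> Loc T A X.
Proof. by move=> AX P _ AP; exact: AP. Qed.
End Triangulated.

(** * Generation by compact objects *)

Section Telescope.
Variables (C : category) (T : triangulation C) (P : C -> Prop).
Hypotheses (copC : has_coproducts C) (LP : is_localizing T P).
Variables (X : nat -> C) (t : forall n, Hom (X n) (X n.+1)).

(* Homotopy colimit of a sequence: the cone of [1 - shift] on its coproduct. *)
Lemma telescope : exists (H : C) (q : forall n, Hom (X n) H),
  [/\ forall n, q n.+1 ∘ t n = q n,
      forall Z (p : forall n, Hom (X n) Z), (forall n, p n.+1 ∘ t n = p n) ->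
        exists u, forall n, u ∘ q n = p n,
      (forall n, P (X n)) -> P H
    & forall (G G' : C) (e : Hom (susp T G') G), is_iso e -> compact G ->
        forall u : Hom G H, exists n (g : Hom G (X n)), u = q n ∘ g].
Proof.
have [S [inj HS]] := copC X.
have [sh [Hsh _]] := HS S (fun n => inj n.+1 ∘ t n).
(* Kronecker delta, transported along [l = k]; it yields the projections [pr k] from the
   coproduct. *)
pose d l k : Hom (X l) (X k) :=
  if l =P k is ReflectT e then ecast z (Hom (X l) (X z)) e (idm _) else 0.
have dk k : d k k = idm _ by rewrite /d; case: eqP => // e; rewrite (eq_axiomK e).
have dlk l k : l != k -> d l k = 0 by rewrite /d; case: eqP.
pose pr k : Hom S (X k) := projT1 (cid (HS (X k) (d^~ k))).
have prE k l : pr k ∘ inj l = d l k := (projT2 (cid (HS (X k) (d^~ k)))).1 l.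
have pr0 : pr 0%N ∘ sh = 0.
  by apply: (coprod_ext HS) => l; rewrite -compA Hsh compA prE dlk // !comp0m.
have prS k : pr k.+1 ∘ sh = t k ∘ pr k.
  apply: (coprod_ext HS) => l; rewrite -!compA Hsh compA !prE.
  have [<-|nlk] := eqVneq l k; first by rewrite !dk comp1m compm1.
  by rewrite !dlk ?comp0m ?compm0 ?eqSS.
(* If [v] is fixed by the shift, its components vanish by induction, since [pr 0 ∘ sh = 0]; a map
   out of a compact object into the coproduct is determined by its components. *)
have phi_inj G : compact G -> forall v : Hom G S, (idm S - sh) ∘ v = 0 -> v = 0.
  move=> cG v; rewrite compBm comp1m => /eqP; rewrite subr_eq0 => /eqP Ev.
  have prv k : pr k ∘ v = 0.
    elim: k => [|k IH]; rewrite Ev compA ?pr0 ?comp0m //.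
    by rewrite prS -compA IH compm0.
  have [/(_ v)[n [s [g [si Eg]]]] _] := cG _ _ _ _ HS.
  rewrite Eg big1 // => k _; suff -> : g k = 0 by rewrite compm0.
  rewrite -(prv (s k)) Eg comp_sumr (bigD1 k) //= big1 ?addr0 => [|l lk].
    by rewrite compA prE dk comp1m.
  by rewrite compA prE dlk ?comp0m // (inj_eq si).
have [H [q [del Hd]]] := dist_ex T (idm S - sh).
have qsh : q ∘ sh = q.
  have /eqP := dist_comp0 Hd.
  by rewrite compmB compm1 subr_eq0 => /eqP.
have qt n : q ∘ inj n.+1 ∘ t n = q ∘ inj n by rewrite -compA -Hsh compA qsh.
exists H, (fun n => q ∘ inj n); split=> //.
- move=> Z p Hp; have [p' [Hp' _]] := HS Z p.
  have [|u Eu] := dist_coexact Hd (u := p').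
    rewrite compmB compm1; apply/eqP; rewrite subr_eq0; apply/eqP.
    by apply: (coprod_ext HS) => n; rewrite -compA Hsh compA !Hp' Hp.
  by exists u => n; rewrite compA -Eu Hp'.
- by move=> PX; apply: (loc_dist LP Hd); apply: (loc_coprod LP HS).
move=> G G' e Ie cG u.
(* The boundary of [u] desuspends to a map [G' -> S] killed by 1 - shift, hence zero; so [u] lifts
   to the coproduct [S]. *)
have du : del ∘ u = 0.
  have [v Ev] := susp_full (del ∘ u ∘ e).
  apply: (iso_epi Ie); rewrite Ev (phi_inj _ (compact_desusp Ie cG) v).
    by rewrite comp0m (add_fmap0 _ _ (susp_add T)).
  apply: (susp_inj (T := T)); rewrite fmapM -Ev (add_fmap0 _ _ (susp_add T)).
  have E : fmap (susp T) (idm S - sh) ∘ del = 0.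
    by apply: oppr_inj; rewrite -compNm oppr0; have /dist_rot/dist_rot/dist_comp0 := Hd.
  by rewrite -!compA (reas1 E) comp0m.
have [v ->] := dist_exact ((dist_rot _ _ _).1 Hd) du.
have [/(_ v)[n [s [g [_ ->]]]] _] := cG _ _ _ _ HS.
(* Finitely many components are pushed along [t] to a common stage and added there. *)
have raise m n' (h : Hom G (X n')) : exists h', q ∘ inj n' ∘ h = q ∘ inj (m + n')%N ∘ h'.
  elim: m => [|m [h' IH]]; first by exists h.
  by exists (t _ ∘ h'); rewrite IH -(qt (m + n')%N) -compA.
elim: n s g => [|n IH] s g; first by exists 0%N, 0; rewrite big_ord0 !compm0.
rewrite big_ord_recl compDr.
have [N [h ->]] := IH (fun k => s (lift ord0 k)) (fun k => g (lift ord0 k)).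
have [h1 E1] := raise N _ (g ord0); have [h2 E2] := raise (s ord0) _ h.
rewrite compA E1 E2; move: h2 {E2}; rewrite [(_ + N)%N]addnC => h2.
by exists (N + s ord0)%N, (h1 + h2); rewrite compDr.
Qed.
End Telescope.

Section Generation.
Variables (C : category) (T : triangulation C).
Hypothesis cgC : compactly_generated T.

(** Replaces the two-sided shift condition of [compactly_generated] by a single family containing
    its own desuspensions, as [cone_vanish] and [telescope] demand. *)
Lemma desuspension_closed_generators : exists (J : small) (G : J -> C) (d : J -> J),
  [/\ forall j, compact (G j),
      forall j, exists e : Hom (susp T (G (d j))) (G j), is_iso e
    & forall x : C, (forall j (f : Hom (G j) x), f = 0) -> is_zero x].
Proof.
have [_ [I [G [cG HG]]]] := cgC.
pose des X : C := projT1 (cid (desusp_ex T X)).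
have [e Ie] : {e : forall X, Hom (susp T (des X)) X & forall X, is_iso (e X)}.
  by exists (fun X => projT1 (cid (projT2 (cid (desusp_ex T X))))) => X;
    exact: (projT2 (cid (projT2 (cid (desusp_ex T X))))).
have des0 n Y x : (forall f : Hom (iter n des Y) x, f = 0) ->
    forall f : Hom Y (iter n (susp T) x), f = 0.
  elim: n x => // n IH x H; rewrite iterSr; apply: IH => f.
  have [g Eg] := susp_full (f ∘ e _); apply: (iso_epi (Ie _)).
  by rewrite Eg (H g) comp0m (add_fmap0 _ _ (susp_add T)).
(* [inl (i, n)] is the n-fold suspension of [G i] and [inr (i, n)] its n-fold desuspension. Both
   copies contain [G i] at n = 0, so desuspending [inl (i, 0)] gives [inr (i, 1)]. *)
exists (I * nat + I * nat)%type, (fun j => match j with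
  | inl (i, n) => iter n (susp T) (G i) | inr (i, n) => iter n des (G i) end),
  (fun j => match j with inl (i, n.+1) => inl (i, n) | inl (i, 0) => inr (i, 1)
    | inr (i, n) => inr (i, n.+1) end); split.
- move=> [[i]|[i]]; elim=> [|n IH] //=; first exact: (compact_susp _ _).1 IH.
  exact: compact_desusp (Ie _) IH.
- move=> [[i [|n]]|[i n]] /=; first by exists (e (G i)).
    by exists (idm _); exact: iso_id.
  by exists (e _).
- move=> x H; apply: HG => i n; split=> f; first exact: (H (inl (i, n))).
  by apply: des0 => g; exact: (H (inr (i, n))).
Qed.

Lemma compact_detect_zero (x : C) :
  (forall c, compact c -> forall f : Hom c x, f = 0) -> is_zero x.
Proof.
move=> H; have [J [G [d [cG _ HG]]]] := desuspension_closed_generators.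
by apply: HG => j; apply: H.
Qed.

(** Cellular approximation: a sequence of objects of [P] over [x] is built so that its homotopy
    colimit maps bijectively to [x] on maps from generators; the cone of that map is then zero. *)
Theorem localizing_compact_all (P : C -> Prop) :
  is_localizing T P -> (forall c, compact c -> P c) -> forall x, P x.
Proof.
move=> LP Pc x; have [copC _] := cgC.
have [J [G [d [cG HdG HG]]]] := desuspension_closed_generators.
pose stage := {X : C & {p : Hom X x | P X}}.
pose map (s : stage) : Hom (projT1 s) x := sval (projT2 s).
have [s0 Hs0] : exists s : stage, forall j (g : Hom (G j) x), exists g', map s ∘ g' = g.
  (* One summand for every map from a generator to [x]; the index type is small because hom groups
     are. *)
  have [X [inj HX]] := copC {j : J & Hom (G j) x} (fun k => G (projT1 k)).
  have [p [Hp _]] := HX x (fun k => projT2 k).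
  have PX : P X by apply: (loc_coprod LP HX) => k; exact: Pc.
  exists (existT _ X (exist _ p PX)) => j g.
  by exists (inj (existT _ j g)); exact: (Hp (existT _ j g)).
(* Coning off all maps from generators that die in [x] kills them at the next stage. *)
have step (s : stage) : exists (s' : stage) (t : Hom (projT1 s) (projT1 s')),
    map s' ∘ t = map s /\ forall j (g : Hom (G j) (projT1 s)), map s ∘ g = 0 -> t ∘ g = 0.
  case: s => X [p PX]; rewrite /map /=.
  have [Q [inj HQ]] := copC {j : J & {g : Hom (G j) X | p ∘ g = 0}} (fun k => G (projT1 k)).
  have [u [Hu _]] := HQ X (fun k => sval (projT2 k)).
  have [X' [t [del Hd]]] := dist_ex T u.
  have [|p' Ep] := dist_coexact Hd (u := p).
    by apply: (coprod_ext HQ) => k; rewrite -compA Hu comp0m; exact: (svalP (projT2 k)).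
  have PX' : P X'.
    by apply: (loc_dist LP Hd) PX; apply: (loc_coprod LP HQ) => k; exact: Pc.
  exists (existT _ X' (exist _ p' PX')), t; split=> // j g pg.
  have /= <- := Hu (existT _ j (exist _ g pg)).
  by rewrite compA (dist_comp0 Hd) comp0m.
pose nxt s := projT1 (cid (step s)).
pose tr s : Hom (projT1 s) (projT1 (nxt s)) := projT1 (cid (projT2 (cid (step s)))).
have trP s : map (nxt s) ∘ tr s = map s /\
    forall j (g : Hom (G j) (projT1 s)), map s ∘ g = 0 -> tr s ∘ g = 0.
  exact: (projT2 (cid (projT2 (cid (step s))))).
pose st n := iter n nxt s0.
have [H [q [qt Hq PH Hc]]] := telescope copC LP (fun n => tr (st n)).
have [p Hp] := Hq x (fun n => map (st n)) (fun n => (trP (st n)).1).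
(* By compactness [u] comes from a finite stage, and the next stage kills it. *)
have p_inj j (u : Hom (G j) H) : p ∘ u = 0 -> u = 0.
  have [e Ie] := HdG j; have [n [g ->]] := Hc _ _ _ Ie (cG j) u.
  rewrite compA Hp => /(trP (st n)).2 tg.
  by rewrite -(qt n) -compA tg compm0.
have [K [k [del Hd]]] := dist_ex T p.
have K0 : is_zero K.
  apply: HG => j; have [e Ie] := HdG j; apply: (cone_vanish Ie Hd) (p_inj _).
  move=> v; have [g <-] := Hs0 j v; exists (q 0%N ∘ g).
  by rewrite compA Hp.
by apply: (loc_iso LP (cone_zero_iso Hd K0)); apply: PH => n; exact: (svalP (projT2 (st n))).
Qed.
End Generation.

(** * Dual pairs in a closed symmetric monoidal category *)

Section Monoidal.
Variable C : csmcat.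
Implicit Types A B X Y Z u v w x : C.

Lemma assocK X Y Z : inv (assoc X Y Z) ∘ assoc X Y Z = idm _.
Proof. by apply: invK; exact: assoc_iso. Qed.
Lemma Kassoc X Y Z : assoc X Y Z ∘ inv (assoc X Y Z) = idm _.
Proof. by apply: Kinv; exact: assoc_iso. Qed.
Lemma iso_tens X X' Y Y' (f : Hom X X') (g : Hom Y Y') :
  is_iso f -> is_iso g -> is_iso (f ⊠ g).
Proof.
move=> [f' [f'f ff']] [g' [g'g gg']]; exists (f' ⊠ g').
by split; rewrite -tensmM ?f'f ?ff' ?g'g ?gg' tensm1.
Qed.
Lemma tens_inv_r W X Y (f : Hom X Y) : is_iso f ->
  (inv f ⊠ idm W) ∘ (f ⊠ idm W) = idm _.
Proof. by move=> If; rewrite -tens_rM invK // tensm1. Qed.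
Lemma tens_rinv_r W X Y (f : Hom X Y) : is_iso f ->
  (f ⊠ idm W) ∘ (inv f ⊠ idm W) = idm _.
Proof. by move=> If; rewrite -tens_rM Kinv // tensm1. Qed.
Lemma tens_inv_l W X Y (f : Hom X Y) : is_iso f ->
  (idm W ⊠ inv f) ∘ (idm W ⊠ f) = idm _.
Proof. by move=> If; rewrite -tens_lM invK // tensm1. Qed.
Lemma tens_rinv_l W X Y (f : Hom X Y) : is_iso f ->
  (idm W ⊠ f) ∘ (idm W ⊠ inv f) = idm _.
Proof. by move=> If; rewrite -tens_lM Kinv // tensm1. Qed.
Lemma tens_lr X X' Y Y' (f : Hom X X') (g : Hom Y Y') :
  (idm X' ⊠ g) ∘ (f ⊠ idm Y) = f ⊠ g.
Proof. by rewrite -tensmM comp1m compm1. Qed.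
Lemma tens_rl X X' Y Y' (f : Hom X X') (g : Hom Y Y') :
  (f ⊠ idm Y') ∘ (idm X ⊠ g) = f ⊠ g.
Proof. by rewrite -tensmM comp1m compm1. Qed.
Lemma tens_swap X X' Y Y' (f : Hom X X') (g : Hom Y Y') :
  (f ⊠ idm Y') ∘ (idm X ⊠ g) = (idm X' ⊠ g) ∘ (f ⊠ idm Y).
Proof. by rewrite tens_lr tens_rl. Qed.

Lemma assocV_nat X X' Y Y' Z Z' (f : Hom X X') (g : Hom Y Y') (h : Hom Z Z') :
  inv (assoc X' Y' Z') ∘ (f ⊠ (g ⊠ h)) = ((f ⊠ g) ⊠ h) ∘ inv (assoc X Y Z).
Proof.
apply: (iso_mono (assoc_iso X' Y' Z')); apply: (iso_epi (assoc_iso X Y Z)).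
by rewrite -!compA assocK compm1 (reasV (Kassoc _ _ _)) assoc_nat.
Qed.
Lemma assoc_nat_r W Z Z' X (h : Hom Z Z') :
  assoc X W Z' ∘ (idm (X ⊗ W) ⊠ h) = (idm X ⊠ (idm W ⊠ h)) ∘ assoc X W Z.
Proof. by rewrite -tensm1 assoc_nat. Qed.
Lemma assoc_nat_l X X' W Z (f : Hom X X') :
  assoc X' W Z ∘ ((f ⊠ idm W) ⊠ idm Z) = (f ⊠ idm (W ⊗ Z)) ∘ assoc X W Z.
Proof. by rewrite assoc_nat tensm1. Qed.
Lemma assocV_nat_r W Z Z' X (h : Hom Z Z') :
  inv (assoc X W Z') ∘ (idm X ⊠ (idm W ⊠ h)) = (idm (X ⊗ W) ⊠ h) ∘ inv (assoc X W Z).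
Proof. by rewrite assocV_nat tensm1. Qed.
Lemma assocV_nat_l X X' W Z (f : Hom X X') :
  inv (assoc X' W Z) ∘ (f ⊠ idm (W ⊗ Z)) = ((f ⊠ idm W) ⊠ idm Z) ∘ inv (assoc X W Z).
Proof. by rewrite -tensm1 assocV_nat. Qed.

Lemma tens_one_l_inj X Y (f g : Hom X Y) : idm (one : C) ⊠ f = idm one ⊠ g -> f = g.
Proof.
by move=> E; apply: (iso_epi (lunit_iso X)); rewrite -!lunit_nat E.
Qed.
Lemma tens_one_r_inj X Y (f g : Hom X Y) : f ⊠ idm (one : C) = g ⊠ idm one -> f = g.
Proof.
by move=> E; apply: (iso_epi (runit_iso X)); rewrite -!runit_nat E.
Qed.

(** Kelly's argument: tensoring with the unit is faithful, and after it the pentagon and the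
    triangle axiom give the equation. *)
Lemma lunit_tens X Y : lunit (X ⊗ Y) ∘ assoc one X Y = lunit X ⊠ idm Y.
Proof.
apply: tens_one_l_inj.
apply: (iso_epi (assoc_iso one (one ⊗ X) Y)).
apply: (iso_epi (iso_tens (assoc_iso one one X) (iso_id Y))).
rewrite tens_lM -!compA [_ ∘ (_ ∘ (assoc _ _ _ ⊠ _))]compA -pentagon_ax.
rewrite (reas1 (triangle_ax _ _)) -[idm (X ⊗ Y)]tensm1 -assoc_nat.
by rewrite (reas (esym (assoc_nat _ _ _))) -tens_rM triangle_ax.
Qed.
Lemma runit_tens X Y : (idm X ⊠ runit Y) ∘ assoc X Y one = runit (X ⊗ Y).
Proof.
apply: tens_one_r_inj; apply: (iso_mono (assoc_iso X Y one)).
rewrite tens_rM (reas (assoc_nat _ _ _)) -triangle_ax tens_lM -!compA.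
rewrite [_ ∘ (_ ∘ (assoc _ _ _ ⊠ _))]compA -pentagon_ax -triangle_ax.
by rewrite (reas (esym (assoc_nat _ _ _))) tensm1.
Qed.
Lemma lunit_one : lunit one = runit one :> Hom (one ⊗ one : C) one.
Proof.
apply: tens_one_r_inj; rewrite -lunit_tens -triangle_ax; congr (_ ∘ _).
by apply: (iso_mono (lunit_iso one)); rewrite lunit_nat.
Qed.
Lemma sym_iso X Y : is_iso (sym X Y).
Proof. by exists (sym Y X); split; exact: symK. Qed.
(** The hexagon on [X], 1, 1 with its units contracted; the invertible map [lunit X ∘ sym X one] is
    then cancelled on the left. *)
Lemma lunit_sym X : lunit X ∘ sym X one = runit X.
Proof.
have Is : is_iso (lunit X ∘ sym X one).
  by apply: iso_comp; [exact: lunit_iso | exact: sym_iso].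
apply/esym/tens_one_r_inj/(iso_mono Is).
have /(congr1 (fun h => lunit X ∘ ((idm one ⊠ lunit X) ∘ h))) := hexagon_ax X one one.
rewrite -!compA (reas1 (triangle_ax _ _)) (reas (esym (sym_nat _ _))).
rewrite -lunit_one triangle_ax => ->.
rewrite [(_ ⊠ lunit X) ∘ _]compA -tens_lM (reas (lunit_nat _)) (reas1 (lunit_tens _ _)).
by rewrite -tens_rM -compA.
Qed.

(** Two hexagons. It expresses the inverse associator through the associator and symmetries, which
    is what interchanges the two triangle identities in [dual_pair_sym]. *)
Lemma sym_reverse A B X :
  assoc A B X ∘ sym X (A ⊗ B) ∘ (idm X ⊠ sym B A) ∘ assoc X B A
    ∘ (sym B X ⊠ idm A) ∘ sym A (B ⊗ X) = idm _.
Proof.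
have sym_assoc Y Z W : assoc Z W Y ∘ sym Y (Z ⊗ W)
    = (idm Z ⊠ sym Y W) ∘ (assoc Z Y W ∘ ((sym Y Z ⊠ idm W) ∘ inv (assoc Y Z W))).
  apply: (iso_epi (assoc_iso Y Z W)); rewrite hexagon_ax -!compA assocK.
  by rewrite compm1.
rewrite -!compA -sym_nat (reas (sym_assoc A X B)) -!compA.
rewrite (reasV (_ : (idm X ⊠ sym B A) ∘ (idm X ⊠ sym A B) = idm _)); last first.
  by rewrite -tens_lM symK tensm1.
rewrite (reas (sym_assoc X A B)) -!compA (reasV (assocK X A B)).
rewrite (reasV (_ : (sym X A ⊠ idm B) ∘ (sym A X ⊠ idm B) = idm _)); last first.
  by rewrite -tens_rM symK tensm1.
by rewrite (reasV (Kassoc _ _ _)) -tens_lM symK tensm1.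
Qed.

(* Locked, so that rewriting with associativity does not look inside. *)
Definition lam x' x (e : Hom (x' ⊗ x) one) v : Hom (x' ⊗ (x ⊗ v)) v :=
  locked (lunit v ∘ (e ⊠ idm v) ∘ inv (assoc x' x v)).
Definition rho x' x (e : Hom (x' ⊗ x) one) v : Hom (v ⊗ x' ⊗ x) v :=
  locked (runit v ∘ (idm v ⊠ e) ∘ assoc v x' x).
Lemma lamE x' x (e : Hom (x' ⊗ x) one) v :
  lam e v = lunit v ∘ (e ⊠ idm v) ∘ inv (assoc x' x v).
Proof. by rewrite /lam -lock. Qed.
Lemma rhoE x' x (e : Hom (x' ⊗ x) one) v :
  rho e v = runit v ∘ (idm v ⊠ e) ∘ assoc v x' x.
Proof. by rewrite /rho -lock. Qed.

Lemma rho_pre x' x y (e : Hom (x' ⊗ x) one) (i : Hom y x') v :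
  rho e v ∘ ((idm v ⊠ i) ⊠ idm x) = rho (e ∘ (i ⊠ idm x)) v.
Proof. by rewrite !rhoE -!compA assoc_nat tens_lM -!compA. Qed.
Lemma rho_post x' x y (e : Hom (x' ⊗ x) one) (i : Hom y x) v :
  rho e v ∘ (idm (v ⊗ x') ⊠ i) = rho (e ∘ (idm x' ⊠ i)) v.
Proof. by rewrite !rhoE -!compA assoc_nat_r tens_lM -!compA. Qed.
Lemma bij_uncurry u w v : bij (fun h : Hom u (ihom w v) => ev w v ∘ (h ⊠ idm w)).
Proof. by apply/bijP; exists (@curry C u w v); [exact: curry_ev | exact: ev_curry]. Qed.

Record dual_pair x' x (e : Hom (x' ⊗ x) one) (n : Hom one (x ⊗ x')) : Prop := DualPair {
  dual_tri1 : runit x ∘ (idm x ⊠ e) ∘ assoc x x' x ∘ (n ⊠ idm x) = lunit x;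
  dual_tri2 : lunit x' ∘ (e ⊠ idm x') ∘ inv (assoc x' x x') ∘ (idm x' ⊠ n) = runit x'
}.

Section Lam.
Variables (x' x : C) (e : Hom (x' ⊗ x) one).
Lemma lam_nat u v (g : Hom u v) :
  lam e v ∘ (idm x' ⊠ (idm x ⊠ g)) = g ∘ lam e u.
Proof.
rewrite !lamE -!compA assocV_nat_r (reas (tens_swap _ _)).
by rewrite (reas (lunit_nat _)).
Qed.
Lemma rho_nat u v (g : Hom u v) :
  rho e v ∘ ((g ⊠ idm x') ⊠ idm x) = g ∘ rho e u.
Proof.
rewrite !rhoE -!compA assoc_nat_l (reas (esym (tens_swap _ _))).
by rewrite (reas (runit_nat _)).
Qed.
Lemma lam_tens u v :
  lam e (u ⊗ v) ∘ (idm x' ⊠ assoc x u v) ∘ assoc x' (x ⊗ u) v = lam e u ⊠ idm v.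
Proof.
have E : inv (assoc x' x (u ⊗ v)) ∘ ((idm x' ⊠ assoc x u v) ∘ assoc x' (x ⊗ u) v)
    = assoc (x' ⊗ x) u v ∘ (inv (assoc x' x u) ⊠ idm v).
  apply: (iso_mono (assoc_iso _ _ _)); rewrite (reasV (Kassoc _ _ _)).
  rewrite (reas1 (pentagon_ax _ _ _ _)) -!compA.
  by rewrite tens_rinv_r ?compm1 //; exact: assoc_iso.
rewrite !lamE -!compA E (reas (esym (assoc_nat_l _ _ _))).
by rewrite (reas1 (lunit_tens _ _)) -!tens_rM compA.
Qed.
Lemma rho_tens u v :
  (idm u ⊠ rho e v) ∘ assoc u (v ⊗ x') x ∘ (assoc u v x' ⊠ idm x) = rho e (u ⊗ v).
Proof.
rewrite !rhoE !tens_lM -!compA [_ ∘ (_ ∘ (assoc _ _ _ ⊠ _))]compA -pentagon_ax.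
by rewrite (reas (esym (assoc_nat_r _ _ _))) (reas1 (runit_tens _ _)).
Qed.
(** In y ⊗ x' ⊗ x ⊗ v the middle pair is contracted, and the resulting unit may be absorbed into
    either neighbour. *)
Lemma rho_assoc y v :
  (rho e y ⊠ idm v) ∘ inv (assoc (y ⊗ x') x v) = (idm y ⊠ lam e v) ∘ assoc y x' (x ⊗ v).
Proof.
apply: (iso_epi (assoc_iso (y ⊗ x') x v)); rewrite -!compA assocK compm1.
rewrite pentagon_ax lamE !tens_lM -!compA.
rewrite (reasV (tens_inv_l _ (assoc_iso _ _ _))).
rewrite (reas (esym (assoc_nat _ _ _))) (reas1 (triangle_ax _ _)).
by rewrite !rhoE !tens_rM !compA.
Qed.
End Lam.

Lemma dual_pair_sym x' x (e : Hom (x' ⊗ x) one) n :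
  dual_pair e n -> dual_pair (e ∘ sym x x') (sym x x' ∘ n).
Proof.
move=> [T1 T2].
have reverse A B X : sym X (A ⊗ B) ∘ (idm X ⊠ sym B A) ∘ assoc X B A
    ∘ (sym B X ⊠ idm A) ∘ sym A (B ⊗ X) = inv (assoc A B X).
  apply: (iso_mono (assoc_iso A B X)); rewrite Kassoc -[RHS](sym_reverse A B X).
  by rewrite -!compA.
split.
  apply: (iso_epi (sym_iso x' one)); rewrite lunit_sym -[RHS]T2 -reverse.
  rewrite tens_rM tens_lM -!compA -sym_nat -lunit_sym -!compA.
  by rewrite (reas (sym_nat _ _)).
rewrite -reverse tens_rM tens_lM -!compA (reas (sym_nat _ _)).
rewrite (reasV (_ : (sym x x' ⊠ idm x) ∘ (sym x' x ⊠ idm x) = idm _)); last first.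
  by rewrite -tens_rM symK tensm1.
rewrite (reas (sym_nat (idm x) (sym x x'))).
rewrite (reasV (_ : (sym x' x ⊠ idm x) ∘ (sym x x' ⊠ idm x) = idm _)); last first.
  by rewrite -tens_rM symK tensm1.
rewrite sym_nat (reas (esym (sym_nat _ _))) (reas1 (lunit_sym _)).
have := congr1 (fun h => h ∘ sym x one) T1.
by rewrite -!compA lunit_sym.
Qed.

Lemma lam_one x' x (e : Hom (x' ⊗ x) one) :
  lam e one ∘ (idm x' ⊠ inv (runit x)) = e.
Proof.
apply: (iso_epi (iso_tens (iso_id x') (runit_iso x))).
rewrite -compA tens_inv_l ?compm1; last exact: runit_iso.
apply: (iso_epi (assoc_iso x' x one)); rewrite -compA runit_tens.
by rewrite !lamE -!compA assocK compm1 lunit_one runit_nat.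
Qed.

(** The coevaluation is the preimage of [runit x'], which makes the second triangle identity its
    definition; the first follows by injectivity at [one ⊗ x]. *)
Lemma dual_pair_of_bij x' x (e : Hom (x' ⊗ x) one) :
  (forall u v, bij (fun g : Hom u (x ⊗ v) => lam e v ∘ (idm x' ⊠ g))) ->
  exists n, dual_pair e n.
Proof.
move=> H; have [n Hn] := (H one x').2 (runit x').
exists n; split; last by rewrite -Hn lamE.
apply: (iso_mono (iso_inv (runit_iso x))); rewrite -!compA (reasV (invK (runit_iso x))).
apply: (H (one ⊗ x) one).1; apply: (iso_epi (assoc_iso x' one x)).
rewrite !tens_lM -!compA (reas1 (lam_one e)) triangle_ax (reas (lam_nat _ _)).
rewrite -assoc_nat; have := lam_tens e x' x; rewrite -!compA => E.
by rewrite (compA (idm x' ⊠ assoc _ _ _)) (compA (lam e _)) E -tens_rM Hn.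
Qed.

(** Postcomposing with the invertible [dual_map] and uncurrying gives the bijection that
    [dual_pair_of_bij] asks for, up to the symmetry. *)
Lemma rigid_dual_pair X : rigid X ->
  exists n : Hom one (ihom X one ⊗ X), dual_pair (ev X one ∘ sym X (ihom X one)) n.
Proof.
move=> RX; apply: dual_pair_of_bij => u v.
(* The reshuffling inside [dual_map] becomes, by the hexagon, the associator that occurs in
   [lam]. *)
have hex : inv (assoc (ihom X one) X v) ∘ ((idm (ihom X one) ⊠ sym v X)
      ∘ (assoc (ihom X one) v X ∘ sym X (ihom X one ⊗ v)))
    = (sym X (ihom X one) ⊠ idm v) ∘ inv (assoc X (ihom X one) v).
  apply: (iso_epi (assoc_iso _ _ _)).
  rewrite -!compA assocK compm1 (compA (assoc _ _ _)) hexagon_ax -!compA.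
  rewrite (reasV (_ : (idm _ ⊠ sym v X) ∘ (idm _ ⊠ sym X v) = idm _)).
    by rewrite (reasV (assocK _ _ _)).
  by rewrite -tens_lM symK tensm1.
have E (g : Hom u (ihom X one ⊗ v)) :
    ev X v ∘ ((dual_map X v ∘ g) ⊠ idm X) ∘ sym X u
    = lam (ev X one ∘ sym X (ihom X one)) v ∘ (idm X ⊠ g).
  rewrite tens_rM -!compA -sym_nat [ev X v ∘ _]compA ev_curry lamE tens_rM -!compA.
  by rewrite -[in RHS](reas hex) -!compA.
apply: (eq_bij E).
apply: (bij_comp (G := fun h => h ∘ sym X u)); first by apply: iso_bij_r; exact: sym_iso.
apply: (bij_comp (G := fun h => ev X v ∘ (h ⊠ idm X))); first exact: bij_uncurry.
exact: iso_bij_l.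
Qed.

Section DualAdjunctions.
Variables (x' x : C) (e : Hom (x' ⊗ x) one) (n : Hom one (x ⊗ x')).
Hypothesis D : dual_pair e n.

Let mu u : Hom u (x ⊗ (x' ⊗ u)) := assoc x x' u ∘ (n ⊠ idm u) ∘ inv (lunit u).
Let nu u : Hom u ((u ⊗ x) ⊗ x') := inv (assoc u x x') ∘ (idm u ⊠ n) ∘ inv (runit u).

Lemma dual_left_triL u : lam e (x' ⊗ u) ∘ (idm x' ⊠ mu u) = idm (x' ⊗ u).
Proof.
apply: (iso_epi (iso_tens (iso_id x') (lunit_iso u))).
apply: (iso_epi (assoc_iso x' one u)).
rewrite /mu !tens_lM -!compA (reasV (tens_inv_l _ (lunit_iso u))) comp1m.
rewrite -assoc_nat; have := lam_tens e x' u; rewrite -!compA => E.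
rewrite (compA (idm x' ⊠ assoc _ _ _)) (compA (lam e _)) E -tens_rM.
by rewrite triangle_ax -(dual_tri2 D) lamE.
Qed.
Lemma dual_left_triR v : (idm x ⊠ lam e v) ∘ mu (x ⊗ v) = idm (x ⊗ v).
Proof.
apply: (iso_epi (lunit_iso (x ⊗ v))); apply: (iso_epi (assoc_iso one x v)).
rewrite /mu -!compA (reasV (invK (lunit_iso _))) comp1m.
rewrite -[(n ⊠ _) ∘ _]assoc_nat_l (compA _ (assoc _ _ _)).
rewrite (compA _ (assoc _ _ _)) -rho_assoc.
rewrite -!compA (reasV (assocK _ _ _)) -tens_rM rhoE (dual_tri1 D).
by rewrite lunit_tens.
Qed.
Lemma dual_right_triL u : rho e (u ⊗ x) ∘ (nu u ⊠ idm x) = idm (u ⊗ x).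
Proof.
rewrite -rho_tens /nu !tens_rM -!compA (reasV (tens_rinv_r _ (assoc_iso _ _ _))).
rewrite (reas (assoc_nat _ _ _)) [_ ∘ (_ ∘ _)]compA -tens_lM rhoE (dual_tri1 D).
by rewrite (reas1 (triangle_ax _ _)) tens_rinv_r //; exact: runit_iso.
Qed.
Lemma dual_right_triR v : (rho e v ⊠ idm x') ∘ nu (v ⊗ x') = idm (v ⊗ x').
Proof.
rewrite /nu -!compA (reas (rho_assoc _ _ _)) (reas (assoc_nat_r _ _ _)).
rewrite [_ ∘ (_ ∘ _)]compA -tens_lM lamE (dual_tri2 D) (reas1 (runit_tens _ _)).
by rewrite Kinv //; exact: runit_iso.
Qed.

(** Transparent, as is [dual_right_adj]: [bij_lam] and [bij_rho] read the counits [lam e] and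
    [rho e] off by conversion. *)
Definition dual_left_adj : adjunction (tens_left x') (tens_left x).
Proof.
apply: (@Adjunction C C (tens_left x') (tens_left x) mu (lam e)) => [X X' f|Y Y' g|X|Y].
- rewrite /mu /= -!compA (reas (esym (assoc_nat_r _ _ _))) (reas (esym (tens_swap _ _))).
  congr (_ ∘ (_ ∘ _)); apply: (iso_mono (lunit_iso _)).
  by rewrite (reasV (Kinv (lunit_iso _))) (reas (lunit_nat _)) Kinv ?compm1 //; exact: lunit_iso.
- exact: lam_nat.
- exact: dual_left_triL.
- exact: dual_left_triR.
Defined.
Definition dual_right_adj : adjunction (tens_right x) (tens_right x').
Proof.
apply: (@Adjunction C C (tens_right x) (tens_right x') nu (rho e)) => [X X' f|Y Y' g|X|Y].
- rewrite /nu /= -!compA -(reas (assocV_nat_l _ _ _)) (reas (tens_swap _ _)).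
  congr (_ ∘ (_ ∘ _)); apply: (iso_mono (runit_iso _)).
  by rewrite (reasV (Kinv (runit_iso _))) (reas (runit_nat _)) Kinv ?compm1 //; exact: runit_iso.
- exact: rho_nat.
- exact: dual_right_triL.
- exact: dual_right_triR.
Defined.

Lemma bij_lam u v : bij (fun g : Hom u (x ⊗ v) => lam e v ∘ (idm x' ⊠ g)).
Proof. exact: (bij_radj dual_left_adj). Qed.
Lemma bij_rho u v : bij (fun g : Hom u (v ⊗ x') => rho e v ∘ (g ⊠ idm x)).
Proof. exact: (bij_radj dual_right_adj). Qed.
End DualAdjunctions.

Lemma tens_left_additive (W : C) : additive_functor (tens_left W).
Proof. by move=> X Y f g; exact: tensmDr. Qed.
Lemma tens_right_coproducts (W : C) : preserves_coproducts (tens_right W).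
Proof. exact: left_adjoint_coproducts (tens_hom_adj W). Qed.
Lemma tens_left_right_adjoint (W : C) : has_right_adjoint (tens_left W).
Proof.
have NI : natural_iso (tens_right W) (tens_left W) (fun X => sym X W).
  by split=> [X Y f|X]; [exact: sym_nat | exact: sym_iso].
exists (ihom_from W); constructor; exact: adjunction_iso_left NI (tens_hom_adj W).
Qed.
Lemma tens_left_coproducts (W : C) : preserves_coproducts (tens_left W).
Proof.
by have [R [a]] := tens_left_right_adjoint W; exact: left_adjoint_coproducts a.
Qed.

(** [x' ⊗ -] is left adjoint to [x ⊗ -], which preserves coproducts. *)
Lemma dual_pair_compact x' x (e : Hom (x' ⊗ x) one) n c :
  dual_pair e n -> compact c -> compact (x' ⊗ c).
Proof.
move=> D; apply: (left_adjoint_compact (dual_left_adj D)).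
  exact: tens_left_additive.
exact: tens_left_coproducts.
Qed.

(** Evaluation hom(1, v) ⊗ 1 -> v is invertible by Yoneda, and so is every factor of [dual_map]. *)
Lemma rigid_one : rigid (one : C).
Proof.
move=> Y; pose D := ihom one one : C.
have Iev v : is_iso (ev one v).
  apply: (iso_cancel_r (f := inv (runit _))); first by apply: iso_inv; exact: runit_iso.
  apply: yoneda_iso => u; apply: eq_bij (bij_comp (iso_bij_r _ _) (bij_uncurry _ _ _)) => [h /=|].
    rewrite -!compA; congr (_ ∘ _).
    apply: (iso_mono (runit_iso _)); rewrite (reas (runit_nat _)) (reasV (Kinv (runit_iso _))).
    exact: (etrans (congr1 _ (Kinv (runit_iso u))) (compm1 _)).
  by apply: iso_inv; exact: runit_iso.
have Icurry u v (h : Hom (u ⊗ one) v) : is_iso h -> is_iso (curry h).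
  move=> Ih; have It : is_iso (curry h ⊠ idm one).
    by apply: (iso_cancel_l (Iev v)); rewrite ev_curry.
  apply: (iso_cancel_r (runit_iso _)); rewrite -runit_nat.
  by apply: iso_comp => //; exact: runit_iso.
have Iaa := iso_inv (assoc_iso D one Y); apply: Icurry; do !apply: iso_comp => //.
- exact: lunit_iso.
- by apply: iso_tens; [exact: Iev | exact: iso_id].
- by apply: iso_tens; [exact: iso_id | exact: sym_iso].
- exact: assoc_iso.
Qed.
End Monoidal.

(** * Tensor-triangulated categories *)

Section TensorTriangulated.
Variable C : ttcat.
Implicit Types W X Y Z a c w x y : C.
Notation "'Σ' X" := (susp (tt_tri C) X) (at level 10, X at level 9).

Lemma susp_tens_swap X Y : exists f : Hom (Σ X ⊗ Y) (X ⊗ Σ Y), is_iso f.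
Proof.
have compat := tt_compat C; pose e := @tt_susp_tens C.
exists (sym (Σ Y) X ∘ (inv (e Y X) ∘ (fmap (susp (tt_tri C)) (sym X Y) ∘ e X Y))).
apply: iso_comp; first exact: sym_iso.
apply: iso_comp; first by apply: iso_inv; exact: (e_iso compat).
apply: iso_comp; last exact: (e_iso compat).
by apply: fmap_iso; exact: sym_iso.
Qed.
Lemma susp_tens_iso X Y : exists f : Hom (Σ X ⊗ Y) (Σ (X ⊗ Y)), is_iso f.
Proof. by exists (tt_susp_tens X Y); exact: (e_iso (tt_compat C)). Qed.

Lemma dist_tens W X Y Z (f : Hom X Y) (g : Hom Y Z) (h : Hom Z (Σ X)) :
  dist f g h -> dist (f ⊠ idm W) (g ⊠ idm W) (tt_susp_tens X W ∘ (h ⊠ idm W)).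
Proof. exact: (tens_dist (tt_compat C)). Qed.

Lemma tens_coexact W X Y Z V (f : Hom X Y) (g : Hom Y Z) (h : Hom Z (Σ X))
    (u : Hom (Z ⊗ W) V) :
  dist f g h -> u ∘ (g ⊠ idm W) = 0 -> exists v : Hom (Σ X ⊗ W) V, u = v ∘ (h ⊠ idm W).
Proof.
move=> H ug; have [v ->] := dist_coexact ((dist_rot _ _ _).1 (dist_tens W H)) ug.
by exists (v ∘ tt_susp_tens X W); rewrite compA.
Qed.

Section Rigid.
Hypothesis rcg : rigidly_compactly_generated C.

Lemma compact_dual c : compact c ->
  exists c' (e : Hom (c ⊗ c') one) n, dual_pair e n.
Proof.
move=> /rcg.2/rigid_dual_pair[n D].
by exists (ihom c one), (ev c one ∘ sym c (ihom c one)), n.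
Qed.
Lemma dual_pair_right_compact c' c (e : Hom (c' ⊗ c) one) n :
  dual_pair e n -> compact c'.
Proof.
move=> D; apply: (compact_iso (runit_iso c')); apply: (dual_pair_compact D).
by apply/rcg.2; exact: rigid_one.
Qed.
Lemma compact_one : compact (one : C).
Proof. by apply/rcg.2; exact: rigid_one. Qed.
Lemma compact_tens c w : compact c -> compact w -> compact (c ⊗ w).
Proof. by move=> /compact_dual[c' [e [n D]]]; exact: (dual_pair_compact D). Qed.

(* Testing vanishing after tensoring with all compact objects makes the class
   of test objects stable under suspension in both directions. *)
Lemma vanish_localizing V :
  is_localizing (tt_tri C) (fun b => forall w, compact w -> forall u : Hom (b ⊗ w) V, u = 0).
Proof.
split=> [X|X Y Z f g h H HX HY w cw u|I y Y inj H Hy w cw u].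
- split=> H w cw u.
    have [s Is] := susp_tens_swap X w; apply: (iso_epi (iso_inv Is)).
    by rewrite comp0m; apply: H; exact: (compact_susp _ _).1 cw.
  have [w' [e Ie]] := desusp_ex (tt_tri C) w.
  have [s Is] := susp_tens_swap X w'.
  apply: (iso_epi (iso_tens (iso_id X) Ie)); apply: (iso_epi Is).
  by rewrite !comp0m; apply: H; exact: compact_desusp Ie cw.
- have [v ->] := tens_coexact H (HY w cw (u ∘ (g ⊠ idm w))).
  have [s Is] := susp_tens_swap X w.
  have -> : v = 0 by apply: (iso_epi (iso_inv Is)); rewrite comp0m; apply: HX;
    exact: (compact_susp _ _).1 cw.
  by rewrite comp0m.
- have Hw : is_coprod (fun i => inj i ⊠ idm w) := @tens_right_coproducts C w _ _ _ _ H.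
  apply: (coprod_ext Hw) => i.
  by rewrite comp0m; exact: Hy.
Qed.

Lemma tens_zero_localizing V :
  is_localizing (tt_tri C) (fun b => is_zero (b ⊗ V)).
Proof.
split=> [X|X Y Z f g h H HX HY|I y Y inj H Hy].
- have [s Is] := susp_tens_iso X V; split=> H0.
    by apply: (zero_iso (iso_inv Is)); exact: susp_zero.
  by apply: (zero_susp (T := tt_tri C)); exact: zero_iso Is H0.
- exact: dist_zero3 (dist_tens V H) HX HY.
- exact: coprod_zero (@tens_right_coproducts C V _ _ _ _ H) Hy.
Qed.
End Rigid.
End TensorTriangulated.

(** * Projection formula and duality *)

Section Geometric.
Variables (D C : ttcat) (f : geometric_functor D C).
Hypotheses (rcgD : rigidly_compactly_generated D) (rcgC : rigidly_compactly_generated C).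
Variables (f_low : functor C D) (a1 : adjunction f f_low).
Implicit Types u v w x z : D.
Implicit Types p q y : C.

Let mul x z : Hom (f x ⊗ f z) (f (x ⊗ z)) := sm_mul (gf_monoidal f) x z.
Let unt : Hom (one : C) (f one) := sm_one (gf_monoidal f).
Let Imul x z : is_iso (mul x z) := sm_mul_iso (gf_monoidal f) x z.
Let Iunt : is_iso unt := sm_one_iso (gf_monoidal f).
Let eps y : Hom (f (f_low y)) y := counit_adj a1 y.

Definition f_pairing x' x (e : Hom (x' ⊗ x) one) : Hom (f x' ⊗ f x) one :=
  inv unt ∘ (fmap f e ∘ mul x' x).

Lemma mul_inv_nat x x' z z' (g : Hom x x') (h : Hom z z') :
  inv (mul x' z') ∘ fmap f (g ⊠ h) = (fmap f g ⊠ fmap f h) ∘ inv (mul x z).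
Proof.
apply: (iso_mono (Imul _ _)); apply: (iso_epi (Imul _ _)).
rewrite -!compA (reasV (Kinv (Imul _ _))) invK // compm1.
exact: esym (sm_mul_nat (gf_monoidal f) g h).
Qed.
Lemma mul_assocV x w z :
  (mul x w ⊠ idm (f z)) ∘ inv (assoc (f x) (f w) (f z))
  = inv (mul (x ⊗ w) z) ∘ (fmap f (inv (assoc x w z)) ∘
      (mul x (w ⊗ z) ∘ (idm (f x) ⊠ mul w z))).
Proof.
apply: (iso_epi (assoc_iso _ _ _)); rewrite -!compA assocK compm1.
have := sm_assoc (gf_monoidal f) x w z; rewrite -!compA => <-.
by rewrite (reasV (fmap_inv _ (assoc_iso _ _ _))) (reasV (invK (Imul _ _))).
Qed.
Lemma mul_nat_l x z z' (h : Hom z z') :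
  mul x z' ∘ (idm (f x) ⊠ fmap f h) = fmap f (idm x ⊠ h) ∘ mul x z.
Proof. by rewrite -(fmap1 f) (sm_mul_nat (gf_monoidal f)). Qed.
Lemma mul_nat_r x x' z (h : Hom x x') :
  mul x' z ∘ (fmap f h ⊠ idm (f z)) = fmap f (h ⊠ idm z) ∘ mul x z.
Proof. by rewrite -(fmap1 f) (sm_mul_nat (gf_monoidal f)). Qed.

Lemma lam_f_pairing x' x (e : Hom (x' ⊗ x) one) w :
  lam (f_pairing e) (f w) ∘ (idm (f x') ⊠ inv (mul x w))
  = fmap f (lam e w) ∘ mul x' (x ⊗ w).
Proof.
apply: (iso_epi (iso_tens (iso_id (f x')) (Imul x w))).
rewrite -!compA tens_inv_l // compm1 !lamE !fmapM /f_pairing !tens_rM -!compA.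
rewrite mul_assocV [_ ∘ (inv _ ∘ _)]compA.
have -> : (fmap f e ⊠ idm (f w)) ∘ inv (mul (x' ⊗ x) w) = inv (mul one w) ∘ fmap f (e ⊠ idm w).
  by rewrite mul_inv_nat fmap1.
have -> : lunit (f w) = fmap f (lunit w) ∘ (mul one w ∘ (unt ⊠ idm (f w))).
  by rewrite compA; exact: esym (sm_lunit (gf_monoidal f) w).
by rewrite -!compA (reasV (tens_rinv_r _ Iunt)) (reasV (Kinv (Imul _ _))).
Qed.

Lemma rho_f_pairing x' x (e : Hom (x' ⊗ x) one) w :
  rho (f_pairing e) (f w) ∘ (inv (mul w x') ⊠ idm (f x))
  = fmap f (rho e w) ∘ mul (w ⊗ x') x.
Proof.
apply: (iso_epi (iso_tens (Imul w x') (iso_id (f x)))).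
rewrite -!compA tens_inv_r // compm1 !rhoE !fmapM /f_pairing !tens_lM -!compA.
have := sm_assoc (gf_monoidal f) w x' x; rewrite -!compA => ->.
rewrite (reas (esym (mul_nat_l _ _))).
have -> : runit (f w) = fmap f (runit w) ∘ (mul w one ∘ (idm (f w) ⊠ unt)).
  by rewrite compA; exact: esym (sm_runit (gf_monoidal f) w).
by rewrite -!compA (reasV (tens_rinv_l _ Iunt)).
Qed.

Lemma f_dual_pair x' x (e : Hom (x' ⊗ x) one) n : dual_pair e n ->
  dual_pair (f_pairing e) (inv (mul x x') ∘ (fmap f n ∘ unt)).
Proof.
move=> [T1 T2]; split.
  rewrite -rhoE !tens_rM (reas1 (rho_f_pairing _ _)) -!compA (reas (mul_nat_r _ _)).
  rewrite (reas1 (esym (fmapM _ _ _))) rhoE T1 compA.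
  exact: (sm_lunit (gf_monoidal f) x).
rewrite -lamE !tens_lM (reas1 (lam_f_pairing _ _)) -!compA (reas (mul_nat_l _ _)).
rewrite (reas1 (esym (fmapM _ _ _))) lamE T2 compA.
exact: (sm_runit (gf_monoidal f) x').
Qed.

(** The transpose of [proj_map]; equations between maps into [f_low _] are checked on transposes,
    where the monoidal coherence of [f] applies. *)
Definition transp x y : Hom (f (x ⊗ f_low y)) (f x ⊗ y) :=
  (idm (f x) ⊠ eps y) ∘ inv (mul x (f_low y)).

Lemma radj_proj x y : radj a1 (proj_map a1 x y) = transp x y.
Proof. exact: radjK. Qed.

Lemma proj_nat_l x x' y (g : Hom x x') :
  fmap f_low (fmap f g ⊠ idm y) ∘ proj_map a1 x y = proj_map a1 x' y ∘ (g ⊠ idm (f_low y)).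
Proof.
apply: (radj_inj (a := a1)).
rewrite radj_post radj_comp !radj_proj /transp -!compA mul_inv_nat fmap1.
by rewrite (reas (tens_swap _ _)).
Qed.
Lemma proj_nat_r x y y' (g : Hom y y') :
  fmap f_low (idm (f x) ⊠ g) ∘ proj_map a1 x y = proj_map a1 x y' ∘ (idm x ⊠ fmap f_low g).
Proof.
apply: (radj_inj (a := a1)).
rewrite radj_post radj_comp !radj_proj /transp -!compA mul_inv_nat fmap1.
rewrite [RHS]compA [LHS]compA -!tens_lM; congr (_ ∘ _); congr (_ ⊠ _).
exact: esym (counit_adj_nat a1 g).
Qed.
Lemma transp_nat_l x x' y (g : Hom x x') :
  (fmap f g ⊠ idm y) ∘ transp x y = transp x' y ∘ fmap f (g ⊠ idm (f_low y)).
Proof. by rewrite -!radj_proj -radj_comp -radj_post proj_nat_l. Qed.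

Lemma lam_transp x' x (e : Hom (x' ⊗ x) one) y :
  lam (f_pairing e) y ∘ (idm (f x') ⊠ transp x y)
  = eps y ∘ (fmap f (lam e (f_low y)) ∘ mul x' (x ⊗ f_low y)).
Proof. by rewrite tens_lM compA lam_nat -compA lam_f_pairing. Qed.

(* Both sides represent [z => Hom (x' ⊗ z) (f_low y)]. *)
Lemma dual_proj_iso x' x (e : Hom (x' ⊗ x) one) n y :
  dual_pair e n -> is_iso (proj_map a1 x y).
Proof.
move=> De; apply: yoneda_iso => z.
have E (g : Hom z (x ⊗ f_low y)) :
    radj a1 (lam e (f_low y) ∘ (idm x' ⊠ g)) ∘ mul x' z
    = lam (f_pairing e) y ∘ (idm (f x') ⊠ radj a1 (proj_map a1 x y ∘ g)).
  rewrite [in RHS]radj_comp radj_proj tens_lM (reas1 (lam_transp _ _)) -!compA.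
  by rewrite mul_nat_l /radj fmapM -!compA.
apply: (@bij_compl _ _ _ (@radj _ _ _ _ a1 z (f x ⊗ y))); last exact: bij_radj.
apply: (@bij_compl _ _ _ (fun h => lam (f_pairing e) y ∘ (idm (f x') ⊠ h))); last first.
  exact: (bij_lam (f_dual_pair De)).
apply: (eq_bij E).
apply: (@bij_comp _ _ _ (fun h => h ∘ mul x' z)); first exact: iso_bij_r.
apply: (@bij_comp _ _ _ (@radj _ _ _ _ a1 _ _)); first exact: bij_radj.
exact: (bij_lam De).
Qed.
Lemma compact_proj_iso x y : compact x -> is_iso (proj_map a1 x y).
Proof.
move=> /(compact_dual rcgD)[x' [e [n De]]].
exact: dual_proj_iso (dual_pair_sym De).
Qed.
Lemma proj_iso_transport x x' y (g : Hom x x') :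
  is_iso g -> is_iso (proj_map a1 x y) -> is_iso (proj_map a1 x' y).
Proof.
move=> Ig Ip; apply: (iso_cancel_r (f := g ⊠ idm (f_low y))).
  by apply: iso_tens => //; exact: iso_id.
rewrite -proj_nat_l; apply: iso_comp => //.
by apply/fmap_iso/iso_tens; [exact: fmap_iso | exact: iso_id].
Qed.

(** Transposition compares Hom(w, x ⊗ f_low y) with Hom(f w, f x ⊗ y), so the five lemma runs on
    triangles in D and their images under [f], without a triangulated structure on [f_low]. *)
Lemma proj_iso_dist x1 x2 x3 y (g : Hom x1 x2) (h : Hom x2 x3)
    (k : Hom x3 (susp (tt_tri D) x1)) : dist g h k ->
  is_iso (proj_map a1 x1 y) -> is_iso (proj_map a1 x2 y) ->
  is_iso (proj_map a1 (susp (tt_tri D) x1) y) ->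
  is_iso (proj_map a1 (susp (tt_tri D) x2) y) -> is_iso (proj_map a1 x3 y).
Proof.
move=> H0 I1 I2 I4 I5; apply: yoneda_iso => w.
pose t x (s : Hom w (x ⊗ f_low y)) := transp x y ∘ fmap f s.
have tE x s : t x s = radj a1 (proj_map a1 x y ∘ s) by rewrite radj_comp radj_proj.
have bt x : is_iso (proj_map a1 x y) -> bij (t x).
  move=> Ip; apply: (eq_bij (fun s => esym (tE x s))).
  apply: (@bij_comp _ _ _ (@radj _ _ _ _ a1 _ _)); first exact: bij_radj.
  exact: iso_bij_l.
have H1 := (dist_rot _ _ _).1 H0; have H2 := (dist_rot _ _ _).1 H1.
set m := - fmap _ g in H1 H2.
have tf := gf_triangulated f; have addf := tf_add tf.
have tB x s s' : t x (s - s') = t x s - t x s' by rewrite /t addf add_fmapN // compmB.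
have t0 x : t x 0 = 0 by rewrite /t add_fmap0 // compm0.
have N x x' (v : Hom x x') s :
    t x' ((v ⊠ idm (f_low y)) ∘ s) = (fmap f v ⊠ idm y) ∘ t x s.
  by rewrite /t fmapM (reas (esym (transp_nat_l _ _))).
suff bt3 : bij (t x3).
  apply: (@bij_compl _ _ _ (@radj _ _ _ _ a1 w (f x3 ⊗ y))); last exact: bij_radj.
  exact: (eq_bij (tE x3)).
have HA0 := dist_tens (f_low y) H0; have HB0 := dist_tens y (tf_dist tf H0).
have HA1 := dist_tens (f_low y) H1; have HB1 := dist_tens y (tf_dist tf H1).
have HA2 := dist_tens (f_low y) H2; have HB2 := dist_tens y (tf_dist tf H2).
apply: (@five_bij _ _ _ _ _ _ _ _ _ _
  (fun s => (g ⊠ idm _) ∘ s) (fun s => (h ⊠ idm _) ∘ s)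
  (fun s => (k ⊠ idm _) ∘ s) (fun s => (m ⊠ idm _) ∘ s)
  (fun s => (fmap f g ⊠ idm _) ∘ s) (fun s => (fmap f h ⊠ idm _) ∘ s)
  (fun s => (fmap f k ⊠ idm _) ∘ s) (fun s => (fmap f m ⊠ idm _) ∘ s)
  (t x1) (t x2) (t x3) (t _) (t _)) => //.
- by move=> s s'; rewrite compmB.
- by move=> s s'; rewrite compmB.
- by move=> s; rewrite compA (dist_comp0 HA0) comp0m.
- by move=> s; rewrite compA (dist_comp0 HB2) comp0m.
- exact: dist_exact HA1 _.
- exact: dist_exact HA2 _.
- exact: dist_exact HB0 _.
- exact: dist_exact HB1 _.
- exact: bt.
- exact: bt.
- exact: bt.
- exact: bt.
Qed.

Variables (f_upp : functor D C) (a2 : adjunction f_low f_upp).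
Let ω : C := omega f_upp.
Let eps2 : Hom (f_low ω) one := counit_adj a2 one.

Theorem projection_formula x y : is_iso (proj_map a1 x y).
Proof.
(* The twist by [w] gives closure under suspension and desuspension; [w = one] returns the claim. *)
pose P x := forall w, compact w -> forall y, is_iso (proj_map a1 (x ⊗ w) y).
suff PD : forall x, P x.
  apply: (proj_iso_transport (runit_iso x)).
  by apply: PD; exact: compact_one.
apply: (localizing_compact_all rcgD.1); last first.
  by move=> c cc w cw z; apply: compact_proj_iso; exact: compact_tens.
split=> [X|X Y Z g h k H HX HY w cw z|I t X inj H HX w cw z].
- split=> H w cw z.
    have [s Is] := susp_tens_swap X w; apply: (proj_iso_transport (iso_inv Is)).
    by apply: H; exact: (compact_susp _ _).1 cw.
  have [w' [e Ie]] := desusp_ex (tt_tri D) w.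
  have [s Is] := susp_tens_swap X w'.
  apply: (proj_iso_transport (iso_tens (iso_id X) Ie)).
  by apply: (proj_iso_transport Is); apply: H; exact: compact_desusp Ie cw.
- have PS X' : P X' -> is_iso (proj_map a1 (susp (tt_tri D) (X' ⊗ w)) z).
    move=> PX'; have [s Is] := susp_tens_iso X' w; have [s' Is'] := susp_tens_swap X' w.
    apply: (proj_iso_transport Is); apply: (proj_iso_transport (iso_inv Is')).
    by apply: PX'; exact: (compact_susp _ _).1 cw.
  by apply: (proj_iso_dist (dist_tens w H)); [exact: HX | exact: HY | exact: PS | exact: PS].
(* [f_low] preserves coproducts because it has the right adjoint [f_upp]; hence both sides of the
   projection map do. *)
- have Hw := @tens_right_coproducts D w _ _ _ _ H.
  have H1 := @tens_right_coproducts D (f_low z) _ _ _ _ Hw.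
  have H2 := left_adjoint_coproducts a2 (@tens_right_coproducts C z _ _ _ _ (@gf_coproducts D C f _ _ _ _ Hw)).
  apply: (@coprod_map_iso D I _ _ _ _ _ _ (fun i => proj_map a1 (t i ⊗ w) z)
    (proj_map a1 (X ⊗ w) z) H1 H2) => i; first exact: HX.
  exact: esym (proj_nat_l _ _).
Qed.

Lemma mul_assoc_inv x w z :
  (idm (f x) ⊠ inv (mul w z)) ∘ (inv (mul x (w ⊗ z)) ∘ fmap f (assoc x w z))
  = assoc (f x) (f w) (f z) ∘ ((inv (mul x w) ⊠ idm (f z)) ∘ inv (mul (x ⊗ w) z)).
Proof.
have E : fmap f (assoc x w z) ∘ (mul (x ⊗ w) z ∘ (mul x w ⊠ idm (f z)))
    = mul x (w ⊗ z) ∘ ((idm (f x) ⊠ mul w z) ∘ assoc (f x) (f w) (f z)).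
  by rewrite !compA; exact: sm_assoc (gf_monoidal f) x w z.
apply: (iso_epi (Imul _ _)); apply: (iso_epi (iso_tens (Imul x w) (iso_id (f z)))).
rewrite -!compA E (reasV (invK (Imul _ _))) (reasV (tens_inv_l _ (Imul _ _))).
by rewrite (reasV (invK (Imul _ _))) tens_inv_r // compm1.
Qed.
Lemma mul_sym_inv x z : inv (mul z x) ∘ fmap f (sym x z) = sym (f x) (f z) ∘ inv (mul x z).
Proof.
have E : fmap f (sym x z) ∘ mul x z = mul z x ∘ sym (f x) (f z).
  exact: sm_sym (gf_monoidal f) x z.
apply: (iso_epi (Imul x z)); rewrite -!compA E invK // compm1.
by rewrite (reasV (invK (Imul _ _))).
Qed.

(** The lax monoidal structure of a right adjoint of a strong monoidal functor, factored through
    [proj_map]; [radj_lax] recovers the usual description. *)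
Definition lax p q : Hom (f_low p ⊗ f_low q) (f_low (p ⊗ q)) :=
  fmap f_low (eps p ⊠ idm q) ∘ proj_map a1 (f_low p) q.

Lemma radj_lax p q : radj a1 (lax p q) = (eps p ⊠ eps q) ∘ inv (mul (f_low p) (f_low q)).
Proof. by rewrite radj_post radj_proj /transp compA tens_rl. Qed.
Lemma lax_l p q u (j : Hom u (f_low p)) :
  lax p q ∘ (j ⊠ idm _) = fmap f_low (radj a1 j ⊠ idm q) ∘ proj_map a1 u q.
Proof. by rewrite /lax -compA -proj_nat_l compA -fmapM -tens_rM. Qed.

Definition proj_right p u : Hom (f_low p ⊗ u) (f_low (p ⊗ f u)) :=
  fmap f_low (sym (f u) p) ∘ proj_map a1 u p ∘ sym (f_low p) u.
Lemma radj_proj_right p u :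
  radj a1 (proj_right p u) = (eps p ⊠ idm (f u)) ∘ inv (mul (f_low p) u).
Proof.
rewrite /proj_right radj_comp radj_post radj_proj /transp -!compA mul_sym_inv.
by rewrite (reas (sym_nat _ _)) (reasV (symK _ _)).
Qed.
Lemma lax_r p q u (j : Hom u (f_low q)) :
  lax p q ∘ (idm _ ⊠ j) = fmap f_low (idm p ⊠ radj a1 j) ∘ proj_right p u.
Proof.
apply: (radj_inj (a := a1)).
rewrite radj_comp radj_lax radj_post radj_proj_right.
rewrite -!compA mul_inv_nat fmap1 compA -tensmM compm1.
by rewrite [RHS]compA tens_lr.
Qed.

(** On transposes this is the associativity coherence of [f]. *)
Lemma lax_assoc x p q :
  proj_map a1 x (p ⊗ q) ∘ ((idm x ⊠ lax p q) ∘ assoc x (f_low p) (f_low q))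
  = fmap f_low (assoc (f x) p q ∘ (transp x p ⊠ idm q)) ∘ proj_map a1 (x ⊗ f_low p) q.
Proof.
apply: (radj_inj (a := a1)).
rewrite radj_comp radj_post !radj_proj fmapM {1}/transp -!compA (reas (mul_inv_nat _ _)).
rewrite fmap1 [_ ∘ (_ ∘ (_ ∘ fmap f (assoc _ _ _)))]compA -tens_lM -[eps _ ∘ _]/(radj a1 _).
rewrite radj_lax tens_lM -!compA mul_assoc_inv (reas (esym (assoc_nat _ _ _))).
congr (_ ∘ _); rewrite /transp compA -tensmM compm1 [RHS]compA -tensmM compm1.
by rewrite comp1m.
Qed.

Let Iproj x y : is_iso (proj_map a1 x y) := projection_formula x y.

Definition tau x : Hom (f_low (f x ⊗ ω)) x :=
  runit x ∘ (idm x ⊠ eps2) ∘ inv (proj_map a1 x ω).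
Lemma psiE x : psi a1 a2 x = ladj a2 (tau x).
Proof. by []. Qed.
Lemma tau_nat x x' (g : Hom x x') :
  tau x' ∘ fmap f_low (fmap f g ⊠ idm ω) = g ∘ tau x.
Proof.
apply: (iso_epi (Iproj x ω)); rewrite /tau -!compA proj_nat_l (reasV (invK (Iproj _ _))).
by rewrite invK // compm1 -(tens_swap g) (reas (runit_nat _)).
Qed.
Lemma psi_nat x x' (g : Hom x x') :
  psi a1 a2 x' ∘ (fmap f g ⊠ idm ω) = fmap f_upp g ∘ psi a1 a2 x.
Proof. by rewrite !psiE ladj_comp ladj_post tau_nat. Qed.

Section Duality.
Variables (p q : C) (b : Hom (q ⊗ p) ω).

Definition low_pairing : Hom (f_low q ⊗ f_low p) one :=
  eps2 ∘ (fmap f_low b ∘ lax q p).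

Lemma low_pairing_l u (j : Hom u (f_low q)) :
  low_pairing ∘ (j ⊠ idm _) = radj a2 (b ∘ (radj a1 j ⊠ idm p)) ∘ proj_map a1 u p.
Proof.
rewrite /low_pairing -[LHS]compA -[_ ∘ lax q p ∘ _]compA lax_l.
by rewrite (compA (fmap f_low b)) -fmapM compA.
Qed.
Lemma low_pairing_r u (j : Hom u (f_low p)) :
  low_pairing ∘ (idm _ ⊠ j) = radj a2 (b ∘ (idm q ⊠ radj a1 j)) ∘ proj_right q u.
Proof.
rewrite /low_pairing -[LHS]compA -[_ ∘ lax q p ∘ _]compA lax_r.
by rewrite (compA (fmap f_low b)) -fmapM compA.
Qed.

(** The bridge between the categories: contraction in D against the induced pairing becomes, after
    adjunction and projection formula, pairing with [b] in C followed by [tau], the transpose of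
    [psi]. *)
Lemma rho_low_pairing u x (s : Hom u (x ⊗ f_low q)) :
  rho low_pairing x ∘ (s ⊠ idm _)
  = tau x ∘ (fmap f_low ((idm (f x) ⊠ b) ∘ assoc (f x) q p
      ∘ (radj a1 (proj_map a1 x q ∘ s) ⊠ idm p)) ∘ proj_map a1 u p).
Proof.
rewrite [in RHS]radj_comp radj_proj tens_rM !fmapM -!compA proj_nat_l.
have E W (k : Hom W _) : fmap f_low (assoc (f x) q p)
    ∘ (fmap f_low (transp x q ⊠ idm p) ∘ (proj_map a1 (x ⊗ f_low q) p ∘ k))
    = proj_map a1 x (q ⊗ p) ∘ ((idm x ⊠ lax q p) ∘ (assoc x (f_low q) (f_low p) ∘ k)).
  by rewrite 2![LHS]compA -fmapM -lax_assoc -!compA.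
rewrite E (reas (proj_nat_r _ _)) (reasV (invK (Iproj _ _))).
by rewrite rhoE /low_pairing !tens_lM -!compA.
Qed.

(* The hypotheses make [f_low p] (resp. [f_low q]) rigid and identify the other
   factor with its dual. *)
Lemma low_pairing_bij :
  (compact (f_low p) /\ forall u : D, bij (fun j : Hom (f u) q => b ∘ (j ⊠ idm p))) \/
  (compact (f_low q) /\ forall u : D, bij (fun j : Hom (f u) p => b ∘ (idm q ⊠ j))) ->
  forall u x, bij (fun s : Hom u (x ⊗ f_low q) => rho low_pairing x ∘ (s ⊠ idm _)).
Proof.
case=> -[cd Hb] u x; set d := f_low _ in cd; have [n Dn] := rigid_dual_pair ((rcgD.2 d).1 cd).
  (* Yoneda identifies [f_low q] with the dual of [d] compatibly with the pairings, which reduces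
     the claim to [bij_rho] for [d]. *)
  pose i : Hom (f_low q) (ihom d one) := curry low_pairing.
  have Ei : ev d one ∘ (i ⊠ idm d) = low_pairing by exact: ev_curry.
  have Ii : is_iso i.
    apply: yoneda_iso => w.
    apply: (@bij_compl _ _ _ (fun h => ev d one ∘ (h ⊠ idm d))); last exact: bij_uncurry.
    have E (j : Hom w (f_low q)) : radj a2 (b ∘ (radj a1 j ⊠ idm p)) ∘ proj_map a1 w p
        = ev d one ∘ ((i ∘ j) ⊠ idm d).
      by rewrite tens_rM compA Ei low_pairing_l.
    apply: (eq_bij E).
    apply: (@bij_comp _ _ _ (fun h => h ∘ proj_map a1 w p)); first exact: iso_bij_r.
    apply: (@bij_comp _ _ _ (@radj _ _ _ _ a2 _ _)); first exact: bij_radj.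
    apply: (@bij_comp _ _ _ (fun j => b ∘ (j ⊠ idm p))) => //; exact: bij_radj.
  have De := dual_pair_sym Dn; rewrite -compA symK compm1 in De.
  apply: eq_bij (bij_comp (bij_rho De u x) (iso_bij_l u (iso_tens (iso_id x) Ii))) => s /=.
  by rewrite tens_rM compA rho_pre Ei.
(* Here [d] is [f_low q], and [f_low p] is identified with its dual; the isomorphism therefore
   enters by precomposition. *)
pose i : Hom (f_low p) (ihom d one) := curry (low_pairing ∘ sym (f_low p) d).
have Ei : ev d one ∘ (i ⊠ idm d) = low_pairing ∘ sym (f_low p) d by exact: ev_curry.
have Ii : is_iso i.
  apply: yoneda_iso => w.
  apply: (@bij_compl _ _ _ (fun h => ev d one ∘ (h ⊠ idm d))); last exact: bij_uncurry.
  have E (j : Hom w (f_low p)) :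
      radj a2 (b ∘ (idm q ⊠ radj a1 j)) ∘ (proj_right q w ∘ sym w d)
      = ev d one ∘ ((i ∘ j) ⊠ idm d).
    by rewrite tens_rM (compA (ev _ _)) Ei -[RHS]compA sym_nat compA [RHS]compA low_pairing_r.
  apply: (eq_bij E).
  apply: (@bij_comp _ _ _ (fun h => h ∘ (proj_right q w ∘ sym w d))).
    apply: iso_bij_r; apply: iso_comp; last exact: sym_iso.
    apply: iso_comp; last exact: sym_iso.
    by apply: iso_comp; [apply: fmap_iso; exact: sym_iso | exact: Iproj].
  apply: (@bij_comp _ _ _ (@radj _ _ _ _ a2 _ _)); first exact: bij_radj.
  apply: (@bij_comp _ _ _ (fun j => b ∘ (idm q ⊠ j))) => //; exact: bij_radj.
have Ii' : is_iso (idm u ⊠ i) by apply: iso_tens => //; exact: iso_id.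
apply: eq_bij (bij_comp (iso_bij_r _ Ii') (bij_rho Dn u x)) => s /=.
rewrite -compA tens_rl -tens_lr compA rho_post -compA sym_nat compA Ei.
by rewrite -!compA symK compm1.
Qed.

Lemma low_pairing_transport u x :
  bij (fun s : Hom u (x ⊗ f_low q) => rho low_pairing x ∘ (s ⊠ idm _)) ->
  bij (fun t : Hom (f u) (f x ⊗ q) => tau x ∘ (fmap f_low ((idm (f x) ⊠ b)
    ∘ assoc (f x) q p ∘ (t ⊠ idm p)) ∘ proj_map a1 u p)).
Proof.
move=> H; apply: (@bij_compr _ _ _ _ (fun s => radj a1 (proj_map a1 x q ∘ s))).
  exact: eq_bij (rho_low_pairing (u := u) (x := x)) H.
apply: (@bij_comp _ _ _ (@radj _ _ _ _ a1 _ _)); first exact: bij_radj.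
exact: iso_bij_l.
Qed.
End Duality.

(** * Closure properties of [Af]; composition with [psi] and [psi_ad] on maps out of it *)

Lemma Af_retract a c (r : Hom a c) (s : Hom c a) : r ∘ s = idm c ->
  Af f_low a -> Af f_low c.
Proof.
move=> rs [ca Ha]; split=> [|y cy]; first exact: compact_retract rs ca.
apply: (compact_retract (s := fmap f_low (s ⊠ idm y)) (r := fmap f_low (r ⊠ idm y))).
  by rewrite -fmapM -tens_rM rs tensm1 fmap1.
exact: Ha.
Qed.
Lemma Af_iso a c (r : Hom a c) : is_iso r -> Af f_low a -> Af f_low c.
Proof. by move=> Ir; apply: (@Af_retract _ _ r (inv r)); exact: Kinv. Qed.
Lemma Af_tens a c : Af f_low a -> compact c -> Af f_low (a ⊗ c).
Proof.
move=> [ca Ha] cc; split=> [|y cy]; first exact: compact_tens.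
apply: (compact_iso (fmap_iso f_low (iso_inv (assoc_iso a c y)))).
by apply: Ha; exact: compact_tens.
Qed.
Lemma Af_low a : Af f_low a -> compact (f_low a).
Proof.
move=> [_ Ha]; apply: (compact_iso (fmap_iso f_low (runit_iso a))).
by apply: Ha; exact: compact_one.
Qed.
(** Writing y ≅ Σy' gives a' ⊗ y ≅ Σa' ⊗ y' ≅ a ⊗ y', so the desuspension is absorbed by the test
    object. *)
Lemma Af_desusp a a' (e : Hom (susp (tt_tri C) a') a) : is_iso e ->
  Af f_low a -> Af f_low a'.
Proof.
move=> Ie [ca Ha]; split=> [|y cy]; first exact: compact_desusp Ie ca.
have [y' [e' Ie']] := desusp_ex (tt_tri C) y; have [s Is] := susp_tens_swap a' y'.
apply: (compact_iso (fmap_iso f_low (iso_tens (iso_id a') Ie'))).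
apply: (compact_iso (fmap_iso f_low Is)).
apply: (compact_isoV (fmap_iso f_low (iso_tens Ie (iso_id y')))).
by apply: Ha; exact: compact_desusp Ie' cy.
Qed.
(** By a triangle identity the dual a' is a retract of a' ⊗ a ⊗ a', which lies in the ideal. *)
Lemma Af_dual a : Af f_low a ->
  exists a' (e : Hom (a' ⊗ a) one) n, dual_pair e n /\ Af f_low a'.
Proof.
move=> Aa; have [a' [e [n De]]] := compact_dual rcgC Aa.1.
have De' := dual_pair_sym De; exists a', (e ∘ sym a' a), (sym a' a ∘ n); split=> //.
have ca' : compact a' by exact: dual_pair_right_compact De'.
move: {De} (e ∘ _) (sym _ _ ∘ _) De' => {e n} e n [_ T2].
apply: (@Af_retract (a' ⊗ (a ⊗ a')) a' (lunit a' ∘ (e ⊠ idm a') ∘ inv (assoc a' a a'))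
  ((idm a' ⊠ n) ∘ inv (runit a'))).
  by rewrite compA T2 Kinv //; exact: runit_iso.
apply: (Af_iso (sym_iso (a ⊗ a') a')); do 2!apply: Af_tens => //.
Qed.

(** Removes the factor [f one] left by taking [u = one] in [low_pairing_transport]. *)
Let iota a : Hom (f one ⊗ a) a := lunit a ∘ (inv unt ⊠ idm a).
Let Iiota a : is_iso (iota a).
Proof.
apply: iso_comp; first exact: lunit_iso.
by apply: iso_tens; [exact: iso_inv | exact: iso_id].
Qed.

Lemma psi_bij a x : Af f_low a -> bij (fun h : Hom a (f x ⊗ ω) => psi a1 a2 x ∘ h).
Proof.
move=> Aa; have [a' [e [n [De _]]]] := Af_dual Aa.
have bTS := low_pairing_transport (low_pairing_bij (p := a) (q := ω ⊗ a') (b := rho e ω)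
  (or_introl (conj (Af_low Aa) (fun u => bij_rho De (f u) ω))) one x).
(* Duality of [a] and [a'] exchanges maps f 1 -> f x ⊗ (ω ⊗ a') with maps f 1 ⊗ a -> f x ⊗ ω, and is
   then cancelled from [bTS]. *)
have bS : bij (fun t : Hom (f one) (f x ⊗ (ω ⊗ a')) =>
    (idm (f x) ⊠ rho e ω) ∘ assoc (f x) (ω ⊗ a') a ∘ (t ⊠ idm a)).
  have Ia := iso_inv (assoc_iso (f x) ω a').
  apply: eq_bij (bij_comp (bij_rho De (f one) (f x ⊗ ω)) (iso_bij_l _ Ia)) => t /=.
  rewrite -rho_tens tens_rM -!compA (reasV (tens_rinv_r _ (assoc_iso _ _ _))).
  by [].
have bT := bij_compr (G := fun k => tau x ∘ (fmap f_low k ∘ proj_map a1 one a)) bTS bS.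
apply: (@bij_compl _ _ _ (@radj _ _ _ _ a2 _ _)); last exact: bij_radj.
apply: (@bij_compl _ _ _ (fun h => h ∘ (fmap f_low (iota a) ∘ proj_map a1 one a))); last first.
  by apply: iso_bij_r; apply: iso_comp => //; exact: fmap_iso.
apply: eq_bij (bij_comp bT (iso_bij_r _ (Iiota a))) => h /=.
by rewrite radj_comp psiE radjK fmapM -!compA.
Qed.

Lemma psi_ad_bij a x : Af f_low a ->
  bij (fun k : Hom a (f x) => psi_ad a1 a2 x ∘ k).
Proof.
move=> Aa; have [a' [e [n [De Aa']]]] := Af_dual Aa.
have bTS := low_pairing_transport (low_pairing_bij (p := a ⊗ ω) (q := a') (b := lam e ω)
  (or_intror (conj (Af_low Aa') (fun u => bij_lam De (f u) ω))) one x).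
(* [rho_assoc] lets [a'] contract with [a] onto [f x] instead of onto [ω], so the variable becomes a
   map f 1 ⊗ a -> f x. *)
have bT : bij (fun k : Hom (f one ⊗ a) (f x) => tau x ∘ (fmap f_low ((k ⊠ idm ω)
    ∘ inv (assoc (f one) a ω)) ∘ proj_map a1 one (a ⊗ ω))).
  apply: bij_compr (bij_rho De (f one) (f x)); apply: eq_bij bTS => t /=.
  congr (_ ∘ (fmap f_low _ ∘ _)).
  by rewrite tens_rM -[RHS]compA -assocV_nat_l [RHS]compA rho_assoc.
apply: (@bij_compl _ _ _ (fun h => ev ω (f_upp x) ∘ (h ⊠ idm ω))); last exact: bij_uncurry.
apply: (@bij_compl _ _ _ (@radj _ _ _ _ a2 _ _)); last exact: bij_radj.
pose j := fmap f_low ((iota a ⊠ idm ω) ∘ inv (assoc (f one) a ω)) ∘ proj_map a1 one (a ⊗ ω).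
have Ij : is_iso j.
  apply: iso_comp => //; apply: fmap_iso; apply: iso_comp.
    by apply: iso_tens => //; exact: iso_id.
  by apply: iso_inv; exact: assoc_iso.
apply: (@bij_compl _ _ _ (fun h => h ∘ j)); last exact: iso_bij_r.
apply: eq_bij (bij_comp bT (iso_bij_r _ (Iiota a))) => k /=.
have -> : ev ω (f_upp x) ∘ ((psi_ad a1 a2 x ∘ k) ⊠ idm ω) = psi a1 a2 x ∘ (k ⊠ idm ω).
  by rewrite tens_rM compA ev_curry.
rewrite radj_comp psiE radjK /j tens_rM -[_ ∘ inv _]compA fmapM.
by rewrite -[RHS]compA (compA (fmap f_low _)).
Qed.
End Geometric.

(** Passes from a right adjoint of Γ_! Γ^* to one of Γ^*; unit and counit are reused because a full
    subcategory keeps the hom groups. *)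
Lemma full_sub_adj (C A : category) (P : A -> Prop) (F : functor C (full_sub P))
    (R : functor A C) : adjunction (inclusion P ⊙ F) R -> adjunction F (R ⊙ inclusion P).
Proof.
move=> a; apply: (@Adjunction C (full_sub P) F (R ⊙ inclusion P) (unit_adj a)
  (fun Y => counit_adj a (sval Y))).
- exact: unit_adj_nat a.
- by move=> Y Y' g; exact: (counit_adj_nat a g).
- exact: adj_triL a.
- by move=> Y; exact: (adj_triR a (sval Y)).
Qed.

(** * Finite colocalization *)

Section FiniteColocalization.
Variables (D C : ttcat) (f : geometric_functor D C).
Hypotheses (rcgD : rigidly_compactly_generated D) (rcgC : rigidly_compactly_generated C).
Variables (f_low : functor C D) (f_upp : functor D C).
Variables (a1 : adjunction f f_low) (a2 : adjunction f_low f_upp).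
Variables (Gamma_upp : functor C (Bf f_low)) (a3 : adjunction (Gamma_low f_low) Gamma_upp).
Let B (b : C) := Loc (tt_tri C) (Af f_low) b.
Let LB : is_localizing (tt_tri C) B := Loc_localizing _ _.
Let ω : C := omega f_upp.

(** Since [Af] is closed under tensoring with compact objects, it satisfies the twisted condition of
    [vanish_localizing]. *)
Lemma colocal_vanish V : (forall a : C, Af f_low a -> forall u : Hom a V, u = 0) ->
  forall b, B b -> forall u : Hom b V, u = 0.
Proof.
move=> H b Bb u.
suff Hw : forall w : C, compact w -> forall v : Hom (b ⊗ w) V, v = 0.
  apply: (iso_epi (runit_iso b)); rewrite comp0m; apply: Hw; exact: compact_one rcgC.
apply: (Bb (fun b => forall w, compact w -> forall v : Hom (b ⊗ w) V, v = 0)).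
  exact: vanish_localizing.
by move=> a Aa w cw v; apply: H; exact: (Af_tens rcgC).
Qed.

(** The cone of [phi] receives no nonzero map from [Af], hence none from the localizing subcategory;
    so [phi] is bijective on maps out of it, and Yoneda with the adjunction concludes. *)
Lemma Gamma_iso X Y (phi : Hom X Y) :
  (forall a, Af f_low a -> bij (fun u : Hom a X => phi ∘ u)) ->
  is_iso (fmap Gamma_upp phi).
Proof.
move=> H; have [K [g [h Hd]]] := dist_ex (tt_tri C) phi.
have K0 : forall a, Af f_low a -> forall u : Hom a K, u = 0.
  move=> a Aa; have [a' [e Ie]] := desusp_ex (tt_tri C) a.
  apply: (cone_vanish Ie Hd); first exact: (H a Aa).2.
  move=> u E; apply: (H a' (Af_desusp Ie Aa)).1.
  by rewrite E compm0.
apply: yoneda_iso => b; apply: (@bij_compl _ _ _ (@radj _ _ _ _ a3 b Y)); last exact: bij_radj.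
have bphi : bij (fun u : Hom (sval b) X => phi ∘ u).
  apply: (cone_bij Hd); first exact: colocal_vanish K0 _ (svalP b).
  by apply: colocal_vanish => //; apply: (loc_susp LB _).1; exact: svalP b.
apply: eq_bij (bij_comp bphi (bij_radj a3 b X)) => u /=.
by rewrite radj_post.
Qed.

Let G x : C := sval (Gamma_upp x).
Let eps x : Hom (G x) x := counit_adj a3 x.

Lemma colocal_tens_cone x K (g : Hom x K) (h : Hom K (susp (tt_tri C) (G x))) :
  dist (eps x) g h -> forall b, B b -> is_zero (b ⊗ K).
Proof.
move=> Hd.
have K0 b : B b -> forall u : Hom b K, u = 0.
  move=> Bb; have [b' [e Ie]] := desusp_ex (tt_tri C) b.
  have bij_eps c : B c -> bij (fun u : Hom c (G x) => eps x ∘ u).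
    by move=> Bc; exact: (bij_radj a3 (exist _ c Bc) x).
  apply: (cone_vanish Ie Hd); first exact: (bij_eps b Bb).2.
  move=> u E; apply: (bij_eps b' (loc_desusp LB Ie Bb)).1.
  by rewrite E compm0.
move=> b Bb; apply: (Bb (fun b => is_zero (b ⊗ K))); first exact: tens_zero_localizing.
move=> a Aa; apply: (compact_detect_zero rcgC.1) => z cz u.
have [a' [e [n [De Aa']]]] := Af_dual rcgC Aa.
(* Hom(z, a ⊗ K) is Hom(a' ⊗ z, K), which vanishes because a' ⊗ z again lies in [Af]. *)
apply: (bij_lam De z K).1; rewrite (K0 _ _ (lam e K ∘ (idm a' ⊠ u))).
  by rewrite [RHS]K0 //; apply: Loc_sub; exact: (Af_tens rcgC).
by apply: Loc_sub; exact: (Af_tens rcgC).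
Qed.

(* The colocalization is smashing: [G one ⊗ G x] maps isomorphically both to
   [G x] and to [x ⊗ G one]. *)
Lemma Gamma_right_adjoint : has_right_adjoint Gamma_upp.
Proof.
pose L := Gamma_low f_low ⊙ Gamma_upp.
have eps_nat X Y (g : Hom X Y) : eps Y ∘ fmap L g = g ∘ eps X := counit_adj_nat a3 g.
have Ieps x b : B b -> is_iso (eps x ⊠ idm b).
  move=> Bb; have [K [g [h Hd]]] := dist_ex (tt_tri C) (eps x).
  apply: (cone_zero_iso (dist_tens b Hd)).
  by apply: (zero_iso (sym_iso b K)); exact: colocal_tens_cone Hd _ Bb.
have NI1 : natural_iso (tens_left (G one) ⊙ L) L (fun x => lunit (G x) ∘ (eps one ⊠ idm (G x))).
  split=> [X Y g|X] /=.
    by rewrite -!compA tens_swap (reas (lunit_nat _)).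
  by apply: iso_comp; [exact: lunit_iso | apply: Ieps; exact: svalP (Gamma_upp X)].
have NI2 : natural_iso (tens_left (G one) ⊙ L) (tens_right (G one))
    (fun x => (eps x ⊠ idm (G one)) ∘ sym (G one) (G x)).
  split=> [X Y g|X] /=.
    rewrite -!compA sym_nat [LHS]compA [RHS]compA -!tens_rM; congr (_ ⊠ _ ∘ _).
    exact: eps_nat.
  by apply: iso_comp; [apply: Ieps; exact: svalP (Gamma_upp one) | exact: sym_iso].
(* Thus Γ_! Γ^* is isomorphic to - ⊗ G 1, and hom(G 1, -) is its right adjoint. *)
have A := adjunction_iso_left NI1
  (adjunction_iso_left (natural_iso_inv NI2) (tens_hom_adj (G one))).
by exists (ihom_from (G one) ⊙ Gamma_low f_low); constructor; exact: full_sub_adj.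
Qed.

Lemma Gamma_psi_natural_iso :
  natural_iso (Gamma_upp ⊙ (tens_left ω ⊙ f)) (Gamma_upp ⊙ f_upp)
    (fun x => fmap Gamma_upp (psi a1 a2 x ∘ sym ω (f x))).
Proof.
split=> [x x' g|x].
  have E : psi a1 a2 x' ∘ sym ω (f x') ∘ (idm ω ⊠ fmap f g)
      = fmap f_upp g ∘ (psi a1 a2 x ∘ sym ω (f x)).
    by rewrite -[LHS]compA sym_nat [LHS]compA (psi_nat rcgD) compA.
  have := congr1 (fmap Gamma_upp) E; rewrite !fmapM; apply.
rewrite fmapM; apply: iso_comp; last by apply: fmap_iso; exact: sym_iso.
by apply: Gamma_iso => a Aa; exact: psi_bij.
Qed.

Lemma Gamma_psi_ad_natural_iso :
  natural_iso (Gamma_upp ⊙ f) (Gamma_upp ⊙ ihom_from ω ⊙ f_upp)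
    (fun x => fmap Gamma_upp (psi_ad a1 a2 x)).
Proof.
split=> [x x' g|x]; last by apply: Gamma_iso => a Aa; exact: psi_ad_bij.
have E : psi_ad a1 a2 x' ∘ fmap f g = ihom_r ω (fmap f_upp g) ∘ psi_ad a1 a2 x.
  by rewrite /psi_ad /ihom_r !curry_nat (psi_nat rcgD) -[in RHS]compA ev_curry.
by have := congr1 (fmap Gamma_upp) E; rewrite !fmapM; apply.
Qed.
End FiniteColocalization.

Theorem theorem1p4 (D C : ttcat)
    (rcgD : rigidly_compactly_generated D) (rcgC : rigidly_compactly_generated C)
    (f : geometric_functor D C)
    (f_low : functor C D) (f_upp : functor D C)
    (a1 : adjunction f f_low) (a2 : adjunction f_low f_upp)
    (Gamma_upp : functor C (Bf f_low))
    (a3 : adjunction (Gamma_low f_low) Gamma_upp) :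
  has_right_adjoint (Gamma_upp ⊙ f_upp) /\
  natural_iso (Gamma_upp ⊙ (tens_left (omega f_upp) ⊙ f)) (Gamma_upp ⊙ f_upp)
    (fun x => fmap Gamma_upp (psi a1 a2 x ∘ sym (omega f_upp) (f x))) /\
  natural_iso (Gamma_upp ⊙ f) (Gamma_upp ⊙ ihom_from (omega f_upp) ⊙ f_upp)
    (fun x => fmap Gamma_upp (psi_ad a1 a2 x)) /\
  has_left_adjoint (Gamma_upp ⊙ f) /\
  (forall (fGamma : functor (Bf f_low) D) (a4 : adjunction fGamma (Gamma_upp ⊙ f)),
     natural_iso (f_low ⊙ (tens_right (omega f_upp) ⊙ Gamma_low f_low)) fGamma
       (left_mate a4 (low_tens_adj a2 a3)
          (fun x => fmap Gamma_upp (psi_ad a1 a2 x)))).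
Proof.
have NIb := Gamma_psi_natural_iso rcgD rcgC a1 a2 a3.
have NIc := Gamma_psi_ad_natural_iso rcgD rcgC a1 a2 a3.
split; [|split=> //; split=> //; split].
(* By (b) it is enough that [f], ω ⊗ - and Γ^* each have a right adjoint. *)
- have [R [A]] := Gamma_right_adjoint rcgC a3.
  have [S [Aω]] := tens_left_right_adjoint (omega f_upp).
  by eexists; constructor; exact: adjunction_iso_left NIb (adj_comp (adj_comp a1 Aω) A).
(* The inverse of the isomorphism in (c) carries the adjunction [low_tens_adj] over to Γ^* f^*. *)
- eexists; constructor.
  exact: adjunction_iso_right (natural_iso_inv NIc) (low_tens_adj a2 a3).
- by move=> fGamma a4; exact: left_mate_iso.
Qed.
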